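(* Let $\mathcal{C}$ be a binary linear block code of length $n$ and rate $R$, and suppose that a codeword of $\mathcal{C}$, chosen uniformly at random, is transmitted over a memoryless binary-input output-symmetric (MBIOS) channel of capacity $C$ (in bits per channel use). Let $\mathbf{X}=(X_1,\dots,X_n)$ be the transmitted codeword and $\mathbf{Y}=(Y_1,\dots,Y_n)$ the received sequence. For an arbitrary representation of $\mathcal{C}$ by a full-rank parity-check matrix, let $\Gamma_k$ be the fraction of its parity-check equations (rows) of degree $k$ (i.e. involving exactly $k$ code bits), and let $\Gamma(x)=\sum_k \Gamma_k x^k$. Then the conditional entropy (in bits) of the transmitted codeword given the received sequence satisfies $$\frac{H(\mathbf{X}\mid\mathbf{Y})}{n} \;\geq\; 1 - C - (1-R)\left(1 - \frac{1}{2\ln 2} \sum_{p=1}^{\infty} \frac{\Gamma(g_p)}{p(2p-1)}\right),$$ where $$g_p = \int_0^{\infty} a(l)\,(1+e^{-l})\, \tanh^{2p}\!\left(\frac{l}{2}\right) dl, \qquad p \in \mathbb{N}=\{1,2,\dots\},$$ and $a$ is the conditional pdf of the log-likelihood ratio at the channel output given that the channel input is $+1$.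
   Context: An MBIOS channel is a memoryless channel with input alphabet $\{+1,-1\}$ and transition law $p_{Y|X}$ that is output-symmetric: $p_{Y|X}(y\mid 1)=p_{Y|X}(-y\mid -1)$ (real output $y$; in general, there is a measurable involution of the output alphabet playing the role of $y\mapsto -y$). Code bits $0,1$ are mapped to the inputs $+1,-1$ respectively. The log-likelihood ratio (LLR) of an output $y$ is $l=\ln\frac{p_{Y|X}(y\mid 1)}{p_{Y|X}(y\mid -1)}$. The ''pdf'' $a$ of the LLR given input $+1$ is understood in the generalized sense: the law of the LLR may contain point masses, including a point mass at $+\infty$ (e.g. for the binary erasure channel), and the integral defining $g_p$ then includes the contribution of that mass with the conventions $e^{-\infty}=0$, $\tanh(\infty)=1$. By channel symmetry, $a(-l)=e^{-l}a(l)$ for $l \ge 0$. The rate is $R=\dim(\mathcal{C})/n$, so a full-rank parity-check matrix of $\mathcal{C}$ has exactly $n(1-R)$ rows, which are linearly independent over $GF(2)$. The capacity $C$ is the mutual information between a uniform input on $\{+1,-1\}$ and the channel output, in bits. Entropies use logarithms to base 2. *)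

(* Defs.v *)
From HB Require Import structures.
From mathcomp Require Import all_boot all_order all_algebra.
From mathcomp Require Import all_classical all_reals all_analysis.
From mathcomp Require Import measurable_realfun.

Set Implicit Arguments.
Unset Strict Implicit.
Unset Printing Implicit Defensive.

Import Order.TTheory GRing.Theory Num.Theory.
Import numFieldNormedType.Exports.

Local Open Scope classical_set_scope.
Local Open Scope ring_scope.

Section information.
Context {R : realType}.

Definition log2 (x : R) : R := ln x / ln 2.

(* [ln 0 = 0] in the library, so that [plogp 0 = 0]. *)
Definition plogp (t : R) : R := - (t * log2 t).

Context {d d' : measure_display} {Omega : measurableType d}.
Variable P : probability Omega R.
Context {A : finType} {U : measurableType d'}.
Variables (X : Omega -> A) (Y : Omega -> U).

(* [q a u] is a version of the conditional probability P(X = a | Y = u). *)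
Record is_cond_pmf (q : A -> U -> R) : Prop := {
  cond_pmf_meas : forall a, measurable_fun [set: U] (q a) ;
  cond_pmf_ge0 : forall a u, 0 <= q a u ;
  cond_pmf_sum1 : forall u, \sum_(a : A) q a u = 1 ;
  cond_pmfE : forall a (B : set U), measurable B ->
    P ([set w | X w = a] `&` Y @^-1` B) =
      (\int[P]_(w in Y @^-1` B) (q a (Y w))%:E)%E }.

(* Two versions agree almost surely, hence the choice of one is immaterial. *)
Definition cond_pmf : A -> U -> R := xget (fun _ _ => 0) is_cond_pmf.

(* H(X | Y) in bits, for X with finitely many values and arbitrary Y. *)
Definition cond_entropy : R :=
  \int[P]_w (\sum_(a : A) plogp (cond_pmf a (Y w))).

End information.

(* A binary-input channel is given by the densities [p x] of the output, with  *)
(* respect to a reference measure mu, when the code bit [x : 'F_2] is sent:    *)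
(* [p 0] stands for p(. | +1) and [p 1] for p(. | -1).                         *)
Section channel.
Context {R : realType} {d : measure_display} {T : measurableType d}.
Variables (mu : {sigma_finite_measure set T -> \bar R}) (p : 'F_2 -> T -> R).

(* [s] plays the role of y |-> -y; like the latter for the Lebesgue and the    *)
(* counting measures, it has to preserve the reference measure.                *)
Record MBIOS : Prop := {
  density_meas : forall x, measurable_fun [set: T] (p x) ;
  density_ge0 : forall x y, 0 <= p x y ;
  density_int1 : forall x, (\int[mu]_y (p x y)%:E = 1)%E ;
  output_symmetric : exists s : T -> T,
    [/\ measurable_fun [set: T] s, involutive s,
        forall B, measurable B -> mu (s @^-1` B) = mu B
      & forall y, p 0 y = p 1 (s y)] }.

Definition output_law (x : 'F_2) (B : set T) : \bar R :=
  (\int[mu]_(y in B) (p x y)%:E)%E.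

(* Mutual information, in bits, between a uniform input and the output.        *)
(* An integrand with [p x y = 0] vanishes.                                     *)
Definition capacity : R :=
  \sum_(x : 'F_2) 2^-1 *
    \int[mu]_y (p x y * log2 (p x y / (2^-1 * \sum_(x' : 'F_2) p x' y))).

(* Since r / 0 = +oo for r > 0, lne 0 = -oo and lne +oo = +oo, this is +oo     *)
(* when only [p 1 y] vanishes and -oo when only [p 0 y] does.                  *)
Definition llr (y : T) : \bar R := lne ((p 0 y)%:E / (p 1 y)%:E)%E.

(* The generalized pdf a: the law of the LLR given the input +1. *)
Definition llr_law : set (\bar R) -> \bar R := pushforward (output_law 0) llr.

Definition tanh (x : R) : R := (expR x - expR (- x)) / (expR x + expR (- x)).

Definition tanhe (x : \bar R) : R :=
  match x with r%:E => tanh r | +oo%E => 1 | -oo%E => -1 end.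

Definition g_ (k : nat) : R :=
  fine (\int[llr_law]_(l in [set l | 0 <= l])
    ((1 + expeR (- l)) * (tanhe (l * 2^-1%:E) ^+ (2 * k))%R%:E))%E.

End channel.

Section code.
Context {R : realType} {n : nat}.

Definition rate (C : {vspace 'rV['F_2]_n}) : R := (\dim C)%:R / n%:R.

Definition full_rank_parity_check (C : {vspace 'rV['F_2]_n}) m
    (H : 'M['F_2]_(m, n)) : Prop :=
  row_free H /\ forall c : 'rV['F_2]_n, (c \in C) = (H *m c^T == 0).

Definition row_degree m (H : 'M['F_2]_(m, n)) (j : 'I_m) : nat :=
  #|[pred i | H j i != 0]|.

Definition degree_fraction m (H : 'M['F_2]_(m, n)) (k : nat) : R :=
  #|[pred j | row_degree H j == k]|%:R / m%:R.

Definition Gamma m (H : 'M['F_2]_(m, n)) : {poly R} :=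
  \poly_(k < n.+1) degree_fraction H k.

End code.

(* X is uniform on C and Y is the output of the memoryless channel (mu, p)     *)
(* when X is its input.                                                        *)
Record transmission {R : realType} {d d' : measure_display}
    {T : measurableType d} (mu : {sigma_finite_measure set T -> \bar R})
    (p : 'F_2 -> T -> R) {n : nat} (C : {vspace 'rV['F_2]_n})
    {Omega : measurableType d'} (P : probability Omega R)
    (X : Omega -> 'rV['F_2]_n) (Y : Omega -> n.-tuple T) : Prop := {
  input_meas : forall c, measurable [set w | X w = c] ;
  output_meas : measurable_fun [set: Omega] Y ;
  input_uniform : forall c, P [set w | X w = c] =
    (if c \in C then #|[pred c' | c' \in C]|%:R^-1 else 0)%:E ;
  memoryless : forall c (B : 'I_n -> set T), (forall i, measurable (B i)) ->
    P ([set w | X w = c] `&` [set w | forall i, B i (tnth (Y w) i)]) =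
      (P [set w | X w = c] * \prod_(i < n) output_law mu p (c ord0 i) (B i))%E }.

(* Main.v *)
(* With t = (p(y|0) - p(y|1)) / (p(y|0) + p(y|1)) = tanh (l/2), one channel    *)
(* output has density 1 + t or 1 - t with respect to the output law nu of a     *)
(* uniform input. Given u in T^n, let beta_u be the product of the laws         *)
(* ((1 + t_i) / 2, (1 - t_i) / 2) on F_2^n. The posterior law of X is beta_u    *)
(* conditioned on C and Y has density 2^n / |C| * beta_u(C) w.r.t. nu^n, which  *)
(* is invariant under the 2^n output flips; a flip by v turns beta_u(C) into    *)
(* beta_u(C + v). Averaging over the flips and using the chain rule,            *)
(*   H(X|Y) = E_{nu^n} (H(beta_u) - H(syndrome under beta_u)).                  *)
(* Here E H(beta_u) = n (1 - capacity), and by Gibbs' inequality the entropy of *)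
(* the syndrome is at most the sum of the entropies of its bits, which have     *)
(* bias tau_j, the product of the t_i over the support of row j. Truncating at  *)
(* N the series 1 - h((1 - tau)/2) = (2 ln 2)^-1 sum_k tau^(2k) / (k (2k - 1)), *)
(* whose terms are nonnegative, bounds them; finally E tau_j^(2k) is g_k to the *)
(* power the degree of row j, and N tends to infinity.                          *)

From HB Require Import structures.
Require Import Defs.
From mathcomp Require Import all_boot all_order all_algebra.
From mathcomp Require Import all_classical all_reals all_analysis.
From mathcomp Require Import measurable_realfun.
From mathcomp Require Import finfield ring lra.

Import Order.TTheory GRing.Theory Num.Theory.
Import numFieldNormedType.Exports.

Local Open Scope classical_set_scope.
Local Open Scope ring_scope.

Set Implicit Arguments.
Unset Strict Implicit.
Unset Printing Implicit Defensive.

(** * Product laws on words and syndromes *)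

(** Symmetry reduces the theorem to an inequality about finite laws. [cond_entropy_information]
    writes H(X|Y) as the mean, over independent outputs drawn from the law of a uniformly fed
    channel, of an entropy of [word_pmf] restricted to the code. That product law is invariant under
    output flips, and a flip by v translates [word_pmf] by v ([word_pmf_flip]); averaging over all
    2^n flips replaces the code by the family of its cosets. What remains in [cond_entropy_average]
    is the entropy of a word with independent letters minus the entropy of its coset, which is the
    entropy of its syndrome.

    For fixed outputs [code_entropy_lower] bounds this from below: the word entropy is the sum of
    the letter entropies, and the syndrome entropy is at most the sum of the entropies of its bits.
    The bias of a syndrome bit is the product of the biases of the letters it checks
    ([syndrome_sgn]), and [nat_entropy_le] bounds the entropy of a bit by a truncated even power
    series in its bias. On integrating, independence turns even moments of products into powers of
    the moments of one output ([information_lower]). Those moments are the g_k ([gE]), the mean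
    letter entropy is 1 - capacity up to the unit of entropy ([capacityE]), and grouping rows by
    degree gives Gamma ([horner_Gamma]). *)

Section bernoulli.
Context {R : realType}.
Implicit Types (x y : 'F_2) (t : R).

(** The nontrivial additive character of F_2: it turns parities into products. *)
Definition sgnF2 x : R := if x == 0 then 1 else -1.

(** The law on F_2 under which [sgnF2] has mean t. *)
Definition bern t x : R := (1 + sgnF2 x * t) / 2.

Lemma F2P x : x = 0 \/ x = 1.
Proof. by case: x => -[|[|//]] i; [left|right]; apply: val_inj. Qed.

Lemma sum_F2 (f : 'F_2 -> R) : \sum_x f x = f 0 + f 1.
Proof.
rewrite (bigD1 0)//= (bigD1 1)//= big1 ?addr0// => x.
by case: (F2P x) => ->; rewrite ?eqxx.
Qed.

Lemma sgnF20 : sgnF2 0 = 1. Proof. by rewrite /sgnF2 eqxx. Qed.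

Lemma sgnF21 : sgnF2 1 = -1. Proof. by []. Qed.

Lemma sgnF2D x y : sgnF2 (x + y) = sgnF2 x * sgnF2 y.
Proof.
have e : 1 + 1 = 0 :> 'F_2 by apply: val_inj.
by case: (F2P x) => ->; case: (F2P y) => ->;
  rewrite ?e ?addr0 ?add0r ?sgnF20 ?sgnF21; lra.
Qed.

Lemma bernE t : (bern t 0 = (1 + t) / 2) * (bern t 1 = (1 - t) / 2).
Proof. by rewrite /bern sgnF20 sgnF21 mul1r mulN1r. Qed.

Lemma bern_sum t : \sum_x bern t x = 1.
Proof. by rewrite sum_F2 !bernE; lra. Qed.

Lemma bern_ge0 t x : `|t| <= 1 -> 0 <= bern t x.
Proof.
by rewrite ler_norml => /andP[? ?]; case: (F2P x) => ->; rewrite bernE; lra.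
Qed.

Lemma bern_le1 t x : `|t| <= 1 -> bern t x <= 1.
Proof.
by rewrite ler_norml => /andP[? ?]; case: (F2P x) => ->; rewrite bernE; lra.
Qed.

Lemma bern_flip t x y : bern (sgnF2 y * t) x = bern t (x + y).
Proof. by rewrite /bern sgnF2D mulrA. Qed.

Lemma indicF2 x y : (x == y)%:R = (1 + sgnF2 y * sgnF2 x) / 2 :> R.
Proof.
by case: (F2P x) => ->; case: (F2P y) => ->;
  rewrite ?eqxx ?sgnF20 ?sgnF21 /=; lra.
Qed.

(** From ln y <= y - 1 at y = 1/x. This uniform bound is what makes the entropies below
    integrable. *)
Lemma xlnx_bound (x : R) : 0 <= x <= 1 -> -1 <= x * ln x <= 0.
Proof.
move=> /andP[x0 x1]; rewrite mulr_ge0_le0 ?ln_le0// andbT.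
move: x0; rewrite le_eqVlt => /predU1P[<-|x0]; first by rewrite mul0r lerN10.
have lnx : - ln x <= x^-1 - 1.
  rewrite -lnV ?posrE// -[X in ln X](subrK 1) addrC le_ln1Dx//.
  by rewrite ltrBrDr addNr invr_gt0.
apply: (@le_trans _ _ (x * (1 - x^-1))); last first.
  by rewrite ler_pM2l// -lerN2 opprB.
by rewrite mulrBr mulr1 divff ?gt_eqF// lerBrDl subrr ltW.
Qed.

End bernoulli.

Section words.
Context {R : realType} {n : nat}.
Implicit Types (u v c : 'rV['F_2]_n) (t : 'I_n -> R).

Lemma sum_row_prod (f : 'I_n -> 'F_2 -> R) :
  \sum_(u : 'rV['F_2]_n) \prod_i f i (u ord0 i) = \prod_i \sum_x f i x.
Proof.
rewrite bigA_distr_bigA.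
rewrite (reindex (fun g : {ffun 'I_n -> 'F_2} => \row_i g i)) /=; last first.
  exists (fun u => [ffun i => u ord0 i]) => [g _|u _].
    by apply/ffunP => i; rewrite ffunE mxE.
  by apply/rowP => i; rewrite mxE ffunE.
by apply: eq_bigr => g _; apply: eq_bigr => i _; rewrite mxE.
Qed.

Definition word_pmf t u : R := \prod_i bern (t i) (u ord0 i).

Lemma word_pmf_sum1 t : \sum_u word_pmf t u = 1.
Proof.
by rewrite (sum_row_prod (fun i => bern (t i))) big1// => i _; rewrite bern_sum.
Qed.

Lemma word_pmf_ge0 t u : (forall i, `|t i| <= 1) -> 0 <= word_pmf t u.
Proof. by move=> t1; apply: prodr_ge0 => i _; rewrite bern_ge0. Qed.

(** The combinatorial form of channel symmetry: changing the signs of the biases along v translates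
    the law by v. *)
Lemma word_pmf_flip t u v :
  word_pmf (fun i => sgnF2 (v ord0 i) * t i) u = word_pmf t (u + v).
Proof. by apply: eq_bigr => i _; rewrite bern_flip mxE. Qed.

Lemma word_pmf_marginal t i (f : 'F_2 -> R) :
  \sum_u word_pmf t u * f (u ord0 i) = \sum_x bern (t i) x * f x.
Proof.
pose g k x := if k == i then bern (t k) x * f x else bern (t k) x.
transitivity (\sum_(u : 'rV['F_2]_n) \prod_k g k (u ord0 k)).
  apply: eq_bigr => u _; rewrite /word_pmf (bigD1 i)//= [in RHS](bigD1 i)//=.
  rewrite /g eqxx mulrAC; congr (_ * _).
  by apply: eq_bigr => k /negbTE ->.
rewrite sum_row_prod (bigD1 i)//= [X in _ * X]big1 ?mulr1.
  by apply: eq_bigr => x _; rewrite /g eqxx.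
by move=> k /negbTE ki; rewrite -[RHS](bern_sum (t k)) /g ki.
Qed.

Lemma ln_prod (I : Type) (s : seq I) (Q : pred I) (f : I -> R) :
  (forall i, Q i -> 0 < f i) ->
  ln (\prod_(i <- s | Q i) f i) = \sum_(i <- s | Q i) ln (f i).
Proof.
move=> f0.
suff [] : 0 < \prod_(i <- s | Q i) f i /\
    ln (\prod_(i <- s | Q i) f i) = \sum_(i <- s | Q i) ln (f i) by [].
elim/big_rec2 : _ => [|i y x Qi [x0 xy]]; first by rewrite ln1.
by rewrite lnM ?posrE ?f0// xy mulr_gt0// f0.
Qed.

(** The entropy, in nats, of a bit of bias s. *)
Definition nat_entropy (s : R) : R :=
  - \sum_x bern s x * ln (bern s x).

(** Additivity of entropy for independent letters: the logarithm of the product splits on words of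
    positive mass, and each summand only sees one marginal. *)
Lemma word_entropy t : (forall i, `|t i| <= 1) ->
  - \sum_u word_pmf t u * ln (word_pmf t u) = \sum_i nat_entropy (t i).
Proof.
move=> t1; rewrite sumrN; congr (- _).
under [RHS]eq_bigr => i _ do
  rewrite -(word_pmf_marginal t i (fun x => ln (bern (t i) x))).
rewrite exchange_big; apply: eq_bigr => u _ /=; rewrite -mulr_sumr.
have [->|/prodf_neq0 b0] := eqVneq (word_pmf t u) 0; first by rewrite !mul0r.
by congr (_ * _); apply: ln_prod => i _; rewrite lt0r b0//= bern_ge0.
Qed.

End words.

(** * Cosets, syndromes and Gibbs' inequality *)

Section parity_check.
Context {R : realType} {n m : nat} (H : 'M['F_2]_(m, n)).
Variable C : {vspace 'rV['F_2]_n}.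
Hypothesis HC : full_rank_parity_check C H.
Implicit Types (u v c : 'rV['F_2]_n) (t : 'I_n -> R).

Definition syndrome u : 'rV['F_2]_m := u *m H^T.

Lemma memCE c : (c \in C) = (syndrome c == 0).
Proof. by rewrite HC.2 -trmx_eq0 trmx_mul trmxK. Qed.

Lemma syndromeD u v : syndrome (u + v) = syndrome u + syndrome v.
Proof. exact: mulmxDl. Qed.

(** Full rank makes the syndrome map onto, and its fibres are the cosets of C. *)
Lemma sum_syndrome (V : nmodType) (f : 'rV['F_2]_m -> V) :
  \sum_u f (syndrome u) = (\sum_s f s) *+ #|C|.
Proof.
(* A section of the syndrome map, from the right inverse that a matrix with independent rows
   possesses. *)
pose lft (s : 'rV['F_2]_m) : 'rV['F_2]_n := s *m (pinvmx H)^T.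
have lftK s : syndrome (lft s) = s.
  rewrite /syndrome /lft -mulmxA -trmx_mul.
  by rewrite (mulmxVp HC.1) trmx1 mulmx1.
rewrite (partition_big syndrome xpredT)// -sumrMnl; apply: eq_bigr => s _.
rewrite (eq_bigr (fun=> f s)) => [|u /andP[_ /eqP ->]//].
rewrite sumr_const; congr (_ *+ _).
rewrite -(fintype.card_image (addIr (- lft s))); apply: eq_card => v.
apply/fintype.imageP/idP => [[u us ->]|vC].
  have {us}/andP[_ /eqP us] : true && (syndrome u == s) := us.
  rewrite memCE syndromeD us /syndrome mulNmx -/(syndrome _).
  by rewrite lftK subrr.
exists (v + lft s); last by rewrite addrK.
suff : true && (syndrome (v + lft s) == s) by [].
by rewrite syndromeD lftK; move: vC; rewrite memCE => /eqP ->; rewrite add0r /=.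
Qed.

Lemma card_code_gt0 : (0 < #|C|)%N.
Proof. by apply/card_gt0P; exists 0; exact: mem0v. Qed.

Lemma card_code : (#|C| * 2 ^ m = 2 ^ n)%N.
Proof.
apply/eqP; rewrite -(eqr_nat rat) mulnC mulrnA.
have := sum_syndrome (fun=> 1 : rat).
by rewrite !sumr_const !card_mx !card_Fp// !mul1n => <-.
Qed.

Lemma dim_code : (\dim C + m = n)%N.
Proof.
have := card_code; rewrite card_vspace card_Fp// -expnD => /eqP.
by rewrite eqn_exp2l// => /eqP.
Qed.

Definition row_support j := [pred i | H j i != 0].

Definition check_bias t j : R := \prod_(i in row_support j) t i.

Lemma check_bias_le1 t j : (forall i, `|t i| <= 1) -> `|check_bias t j| <= 1.
Proof.
by move=> t1; rewrite normr_prod prodr_ile1// => i _; rewrite normr_ge0 t1.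
Qed.

(** The sign of a parity is the product of the signs of the bits involved. By independence the mean
    factors: a letter in the support contributes its bias, any other letter contributes 1. *)
Lemma syndrome_sgn t j :
  \sum_u word_pmf t u * sgnF2 (syndrome u ord0 j) = check_bias t j.
Proof.
pose g i x := bern (t i) x * sgnF2 (x * H j i).
transitivity (\sum_(u : 'rV['F_2]_n) \prod_i g i (u ord0 i)).
  apply: eq_bigr => u _; rewrite big_split; congr (_ * _).
  rewrite mxE (big_morph _ (@sgnF2D R) (@sgnF20 R)).
  by apply: eq_bigr => i _; rewrite mxE.
rewrite sum_row_prod /check_bias [RHS]big_mkcond; apply: eq_bigr => i _ /=.
rewrite inE /g sum_F2 mul0r mul1r sgnF20 !bernE.
by case: (F2P (H j i)) => -> /=; rewrite ?sgnF20 ?sgnF21; lra.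
Qed.

(** A law on F_2 is determined by the mean of the sign, so [syndrome_sgn] suffices once the
    indicator of x is expanded by [indicF2]. *)
Lemma syndrome_marginal t j (f : 'F_2 -> R) :
  \sum_u word_pmf t u * f (syndrome u ord0 j) =
  \sum_x bern (check_bias t j) x * f x.
Proof.
have fE y : f y = \sum_x (y == x)%:R * f x.
  by rewrite (bigD1 y)//= eqxx mul1r big1 ?addr0// => x;
    rewrite eq_sym => /negbTE ->; rewrite mul0r.
under eq_bigr do rewrite fE mulr_sumr.
rewrite exchange_big; apply: eq_bigr => x _ /=.
under eq_bigr do rewrite mulrA.
rewrite -mulr_suml; congr (_ * _); rewrite /bern -(syndrome_sgn t j).
under eq_bigr do rewrite indicF2 mulrA mulrDr mulr1.
rewrite -mulr_suml big_split /= word_pmf_sum1 mulr_sumr.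
by congr ((_ + _) / _); apply: eq_bigr => u _; ring.
Qed.

(** The mass of the coset u + C, equivalently the probability of the syndrome of u. *)
Definition coset_pmf t u : R := \sum_(c in C) word_pmf t (c + u).

Lemma coset_pmf_shift t u c : c \in C -> coset_pmf t (u + c) = coset_pmf t u.
Proof.
move=> cC; rewrite /coset_pmf (reindex_inj (addIr (- c))) /=.
by apply: eq_big => [x|x _]; [rewrite rpredBr|rewrite addrA addrAC subrK addrC].
Qed.

Lemma coset_pmf_ge t u : (forall i, `|t i| <= 1) ->
  word_pmf t u <= coset_pmf t u.
Proof.
move=> t1; rewrite /coset_pmf (bigD1 0) ?mem0v//= add0r lerDl.
by apply: sumr_ge0 => c _; exact: word_pmf_ge0.
Qed.

(** The law the syndrome would have if its bits were independent with their true marginals; it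
    serves as comparison law in Gibbs' inequality. *)
Definition syndrome_pmf t u : R :=
  \prod_j bern (check_bias t j) (syndrome u ord0 j).

(* [syndrome_pmf] is constant on the cosets of [C], so that averaging over     *)
(* [C] turns [word_pmf / coset_pmf] into (at most) [1 / #|C|].                 *)
Lemma sum_syndrome_ratio t : (forall i, `|t i| <= 1) ->
  \sum_u word_pmf t u * (syndrome_pmf t u / coset_pmf t u) <= 1.
Proof.
move=> t1; set F := fun u => syndrome_pmf t u / coset_pmf t u.
have s0 u : 0 <= syndrome_pmf t u.
  by apply: prodr_ge0 => j _; rewrite bern_ge0// check_bias_le1.
have FC u c : c \in C -> F (u + c) = F u.
  move=> cC; rewrite /F coset_pmf_shift// /syndrome_pmf syndromeD.
  by move: (cC); rewrite memCE => /eqP ->; rewrite addr0.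
have C0 : 0 < #|C|%:R :> R by rewrite ltr0n card_code_gt0.
rewrite -(ler_pM2l C0) mulr1 mulr_natl -sumr_const.
under eq_bigr => c _ do rewrite (reindex_inj (addIr c)) /=.
rewrite exchange_big /=.
have -> : #|C|%:R = \sum_u syndrome_pmf t u.
  rewrite (sum_syndrome (fun s => \prod_j bern (check_bias t j) (s ord0 j))).
  rewrite (sum_row_prod (fun j => bern (check_bias t j))) big1// => j _.
  by rewrite bern_sum.
apply: ler_sum => u _.
under eq_bigr => c cC do rewrite -/(F _) FC// addrC.
rewrite -mulr_suml -/(coset_pmf t u) /F mulrCA.
have [->|b0] := eqVneq (coset_pmf t u) 0; first by rewrite mul0r mulr0.
by rewrite divff// mulr1.
Qed.

Lemma check_bern_gt0 t u j : (forall i, `|t i| <= 1) -> 0 < word_pmf t u ->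
  0 < bern (check_bias t j) (syndrome u ord0 j).
Proof.
move=> t1 b0; apply: (lt_le_trans b0).
have := syndrome_marginal t j (fun x => (x == syndrome u ord0 j)%:R).
rewrite [X in _ = X](bigD1 (syndrome u ord0 j))//= eqxx mulr1.
rewrite [X in _ = _ + X]big1 => [|x /negbTE ->]; last by rewrite mulr0.
rewrite addr0 => <-; rewrite (bigD1 u)//= eqxx mulr1 lerDl.
by apply: sumr_ge0 => v _; rewrite mulr_ge0// word_pmf_ge0.
Qed.

(** Gibbs' inequality: apply ln x <= x - 1 to the ratio of [syndrome_pmf] to [coset_pmf] and sum
    with [sum_syndrome_ratio]. *)
Lemma coset_cross_entropy t : (forall i, `|t i| <= 1) ->
  \sum_u word_pmf t u * ln (syndrome_pmf t u) <=
  \sum_u word_pmf t u * ln (coset_pmf t u).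
Proof.
move=> t1; rewrite -subr_le0 -sumrB.
apply: (@le_trans _ _ (\sum_u (word_pmf t u * (syndrome_pmf t u / coset_pmf t u)
    - word_pmf t u))); last first.
  by rewrite sumrB word_pmf_sum1 subr_le0 sum_syndrome_ratio.
apply: ler_sum => u _.
(* Words of mass 0 contribute nothing; on the others both the coset and every bit marginal have
   positive mass, so the logarithms are genuine. *)
have [->|b0] := eqVneq (word_pmf t u) 0; first by rewrite !mul0r subrr.
have {}b0 : 0 < word_pmf t u by rewrite lt0r b0 word_pmf_ge0.
have c0 : 0 < coset_pmf t u by rewrite (lt_le_trans b0)// coset_pmf_ge.
have s0 : 0 < syndrome_pmf t u.
  by apply: prodr_gt0 => j _; exact: check_bern_gt0 b0.
rewrite -mulrBr -[X in _ <= _ - X]mulr1 -mulrBr ler_pM2l//.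
rewrite -lnV ?posrE// -lnM ?posrE ?invr_gt0//.
rewrite -[X in ln X](subrK 1) addrC le_ln1Dx//.
by rewrite ltrBrDr addNr divr_gt0.
Qed.

(** The right side is the entropy of the word minus that of its syndrome; the latter is at most the
    cross entropy with the product of the marginals, which is the sum of the bit entropies. *)
Lemma code_entropy_lower t : (forall i, `|t i| <= 1) ->
  \sum_i nat_entropy (t i) - \sum_j nat_entropy (check_bias t j) <=
  \sum_u word_pmf t u * (ln (coset_pmf t u) - ln (word_pmf t u)).
Proof.
move=> t1; under [leRHS]eq_bigr do rewrite mulrBr.
rewrite sumrB -word_entropy// [leRHS]addrC lerD2l.
apply: le_trans (coset_cross_entropy t1).
rewrite sumrN opprK.
under eq_bigr => j _ do
  rewrite -(syndrome_marginal t j (fun x => ln (bern (check_bias t j) x))).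
rewrite exchange_big /=; apply: ler_sum => u _; rewrite -mulr_sumr.
have [->|b0] := eqVneq (word_pmf t u) 0; first by rewrite !mul0r.
rewrite le_eqVlt; apply/orP; left; apply/eqP; congr (_ * _).
by apply/esym/ln_prod => j _; rewrite check_bern_gt0// lt0r b0 word_pmf_ge0.
Qed.

(** As v varies, each word c + v is met once for every c in C, and the mass of its coset does not
    depend on c. *)
Lemma code_entropy_average t : 
  \sum_v \sum_(c in C) word_pmf t (c + v) *
      (ln (coset_pmf t v) - ln (word_pmf t (c + v))) =
  #|C|%:R * \sum_u word_pmf t u * (ln (coset_pmf t u) - ln (word_pmf t u)).
Proof.
rewrite exchange_big /= mulr_natl -sumr_const; apply: eq_bigr => c cC.
rewrite [RHS](reindex_inj (addrI c)) /=; apply: eq_bigr => u _.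
by rewrite [c + u]addrC coset_pmf_shift.
Qed.

Lemma coset_pmf_le1 t u : (forall i, `|t i| <= 1) -> coset_pmf t u <= 1.
Proof.
move=> t1; rewrite -(word_pmf_sum1 t) /coset_pmf [leRHS](reindex_inj (addIr u)) /=.
rewrite [leLHS]big_mkcond; apply: ler_sum => c _.
by case: ifP => // _; rewrite word_pmf_ge0.
Qed.

(** A word weighs no more than its coset, which weighs at most 1; so the term lies between 0 and - w
    ln w, where w is the mass of the word. *)
Lemma coset_term_bound t u : (forall i, `|t i| <= 1) ->
  0 <= word_pmf t u * (ln (coset_pmf t u) - ln (word_pmf t u)) <= 1.
Proof.
move=> t1; have := word_pmf_ge0 u t1.
rewrite le_eqVlt => /predU1P[<-|w0]; first by rewrite mul0r lexx ler01.
have wc := coset_pmf_ge u t1; have c0 := lt_le_trans w0 wc.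
have c1 := coset_pmf_le1 u t1.
have /andP[wl _] : -1 <= word_pmf t u * ln (word_pmf t u) <= 0.
  by rewrite xlnx_bound// (ltW w0)/= (le_trans wc).
rewrite mulr_ge0 ?subr_ge0 ?ler_ln ?posrE ?(ltW w0)//= mulrBr.
have wlc : word_pmf t u * ln (coset_pmf t u) <= 0.
  by rewrite mulr_ge0_le0 ?(ltW w0)// ln_le0.
by rewrite lerBlDr; apply: (le_trans wlc); rewrite -lerBlDl sub0r.
Qed.

(** The mass of C times the entropy, in nats, of [word_pmf] conditioned on C. *)
Definition code_information t : R := \sum_(c in C) word_pmf t c *
  (ln (coset_pmf t 0) - ln (word_pmf t c)).

Lemma code_information_ge0 t : (forall i, `|t i| <= 1) ->
  0 <= code_information t.
Proof.
move=> t1; apply: sumr_ge0 => c cC; rewrite -(coset_pmf_shift t 0 cC) add0r.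
by have /andP[] := coset_term_bound c t1.
Qed.

Lemma code_information_bound t : (forall i, `|t i| <= 1) ->
  `|code_information t| <= #|C|%:R.
Proof.
move=> t1; rewrite ger0_norm ?code_information_ge0// -sumr_const.
apply: ler_sum => c cC; rewrite -(coset_pmf_shift t 0 cC) add0r.
by have /andP[] := coset_term_bound c t1.
Qed.

Lemma sum_code_information t :
  \sum_(v : 'rV['F_2]_n) code_information (fun i => sgnF2 (v ord0 i) * t i) =
  #|C|%:R * \sum_u word_pmf t u * (ln (coset_pmf t u) - ln (word_pmf t u)).
Proof.
rewrite -code_entropy_average; apply: eq_bigr => v _; apply: eq_bigr => c _.
rewrite !word_pmf_flip; congr (_ * (ln _ - _)).
by apply: eq_bigr => c' _; rewrite word_pmf_flip addr0.
Qed.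

End parity_check.

(** * Power series of the binary entropy *)

Section binary_entropy_series.
Context {R : realType}.
Implicit Types (x : R) (N k : nat).

(** The coefficient of x^(2k) in (1 + x) ln (1 + x) + (1 - x) ln (1 - x). *)
Definition entropy_coef k : R := (k%:R * (2 * k%:R - 1))^-1.

Lemma entropy_coef_ge0 k : 0 <= entropy_coef k.
Proof.
case: k => [|k]; first by rewrite /entropy_coef mul0r invr0.
rewrite invr_ge0 mulr_ge0 // subr_ge0 -natrM ler1n muln_gt0.
Qed.

Definition entropy_poly N : {poly R} :=
  \sum_(1 <= k < N) entropy_coef k *: 'X^(2 * k).

Lemma horner_entropy_poly N x :
  (entropy_poly N).[x] = \sum_(1 <= k < N) entropy_coef k * x ^+ (2 * k).
Proof.
by rewrite horner_sum; apply: eq_bigr => k _; rewrite hornerZ hornerXn.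
Qed.

Lemma ge0_derive_le (f df : R -> R) x : 0 <= x ->
  (forall y, 0 <= y <= x -> is_derive y 1 f (df y)) ->
  (forall y, 0 <= y <= x -> 0 <= df y) -> f 0 <= f x.
Proof.
move=> x0 fdf df0.
have I y : y \in `[0, x] -> 0 <= y <= x by rewrite in_itv.
have O y : y \in `]0, x[ -> 0 <= y <= x.
  by rewrite in_itv => /andP[/ltW -> /ltW ->].
apply: (@ger0_derive1_ndecr _ _ 0 x) => // [y /O y0x|y /O y0x|].
- by have [] := fdf _ y0x.
- by rewrite derive1E (@derive_val _ _ _ _ _ _ _ (fdf _ y0x)) df0.
- by apply: derivable_within_continuous => y /I y0x; have [] := fdf _ y0x.
Qed.

Lemma deriv_entropy_poly N : (entropy_poly N)^`() =
  \sum_(1 <= k < N) entropy_coef k *: 'X^((2 * k).-1) *+ (2 * k).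
Proof.
rewrite [LHS]raddf_sum; apply: eq_bigr => k _.
by rewrite /= derivZ derivXn scalerMnr.
Qed.

(** Differentiating twice cancels the coefficients and leaves a partial sum of the geometric series
    of 2 / (1 - x^2). *)
Lemma entropy_poly_deriv2_le N x : 0 <= x < 1 ->
  (entropy_poly N)^`()^`().[x] <= (1 + x)^-1 + (1 - x)^-1.
Proof.
move=> /andP[x0 x1].
have -> : (entropy_poly N)^`()^`().[x] = 2 * \sum_(1 <= k < N) (x ^+ 2) ^+ k.-1.
  rewrite deriv_entropy_poly [_^`()]raddf_sum horner_sum mulr_sumr.
  rewrite !big_nat; apply: eq_bigr => k /andP[k1 _].
  rewrite /= derivMn derivZ derivXn hornerMn hornerZ hornerMn hornerXn.
  case: k k1 => // k _.
  have -> : ((2 * k.+1).-2 = 2 * k)%N by rewrite mulnS.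
  rewrite /= -exprM -(mulr_natl _ (2 * k.+1)) -(mulr_natl _ (2 * k.+1).-1).
  rewrite mulrCA !mulrA; congr (_ * _); rewrite /entropy_coef.
  have -> : (2 * k.+1).-1%:R = 2 * k.+1%:R - 1 :> R.
    by rewrite -subn1 natrB ?muln_gt0// natrM.
  have k1 : 1 <= k.+1%:R :> R by rewrite ler1n.
  by rewrite natrM; field; apply/andP; split; lra.
have -> : (1 + x)^-1 + (1 - x)^-1 = 2 / (1 - x ^+ 2).
  by field; repeat (apply/andP; split); nra.
rewrite ler_pM2l// -[leRHS]mul1r ler_pdivlMr; last by rewrite subr_gt0 exprn_ilt1.
case: N => [|N]; first by rewrite big_geq// mul0r.
rewrite big_add1 /= big_mkord mulrC -opprB mulNr -subrX1.
by rewrite opprB gerBl exprn_ge0// exprn_ge0.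
Qed.

(** Integrate the comparison of second derivatives twice from 0, where both sides and their first
    derivatives vanish. *)
Lemma entropy_poly_lt1 N x : 0 <= x < 1 ->
  (entropy_poly N).[x] <= (1 + x) * ln (1 + x) + (1 - x) * ln (1 - x).
Proof.
move=> /andP[x0 x1]; set P := entropy_poly N.
have P0 : P.[0] = 0.
  rewrite horner_entropy_poly big_nat big1// => k /andP[k1 _].
  by rewrite expr0n muln_eq0 /= -leqn0 leqNgt k1 mulr0.
have P0' : P^`().[0] = 0.
  rewrite deriv_entropy_poly horner_sum big_nat big1// => -[//|k] _.
  by rewrite hornerMn hornerZ hornerXn mulnS expr0n /= mulr0 mul0rn.
have [D1 D2] : (forall y, 0 <= y <= x ->
      is_derive y 1 (fun z : R => ln (1 + z)) (1 + y)^-1) /\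
    (forall y, 0 <= y <= x ->
      is_derive y 1 (fun z : R => ln (1 - z)) (- (1 - y)^-1)).
  split=> y yx.
  - have /is_derive1_ln lny : 0 < 1 + y by lra.
    have : is_derive y 1 (fun z : R => 1 + z) 1.
      apply: (is_derive_eq (is_deriveD (is_derive_cst (1 : R^o) y 1)
        (is_derive_id y 1))).
      by rewrite add0r.
    by move=> /(is_derive1_comp lny); rewrite mulr1.
  - have /is_derive1_ln lny : 0 < 1 - y by lra.
    have : is_derive y 1 (fun z : R => 1 - z) (-1).
      apply: (is_derive_eq (is_deriveB (is_derive_cst (1 : R^o) y 1)
        (is_derive_id y 1))).
      by rewrite sub0r.
    move=> /(@is_derive1_comp _ (@ln R) (fun z => 1 - z) _ _ _ lny).
    by rewrite mulrN mulr1.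
have S1 y : 0 <= y <= x -> P^`().[y] <= ln (1 + y) - ln (1 - y).
  move=> /andP[y0 yx]; rewrite -subr_ge0.
  pose f z := ln (1 + z) - ln (1 - z) - P^`().[z].
  have -> : 0 = f 0 by rewrite /f addr0 subr0 P0' subr0 subrr.
  apply: (@ge0_derive_le f
    (fun z => (1 + z)^-1 + (1 - z)^-1 - P^`()^`().[z])) => //.
  - move=> z /andP[z0 zy]; rewrite /f.
    have zx : 0 <= z <= x by rewrite z0 (le_trans zy).
    have d1 := D1 z zx; have d2 := D2 z zx; have dP := is_derive_poly P^`() z.
    apply: (is_derive_eq (is_deriveB (is_deriveB d1 d2) dP)).
    by rewrite opprK.
  - move=> z /andP[z0 zy]; rewrite subr_ge0 entropy_poly_deriv2_le// z0.
    by rewrite (le_lt_trans zy)// (le_lt_trans yx).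
rewrite -subr_ge0.
pose f z := (1 + z) * ln (1 + z) + (1 - z) * ln (1 - z) - P.[z].
have -> : 0 = f 0 by rewrite /f addr0 subr0 P0 ln1 mulr0 addr0 subr0.
apply: (@ge0_derive_le f (fun z => ln (1 + z) - ln (1 - z) - P^`().[z])) => //.
- move=> z zx; rewrite /f.
  have d1 := D1 z zx; have d2 := D2 z zx; have dP := is_derive_poly P z.
  have e1 := is_deriveD (is_derive_cst (1 : R^o) z 1) (is_derive_id z 1).
  have e2 := is_deriveB (is_derive_cst (1 : R^o) z 1) (is_derive_id z 1).
  apply: (is_derive_eq
    (is_deriveB (is_deriveD (is_deriveM e1 d1) (is_deriveM e2 d2)) dP)).
  (* The product rule produces scalings; they are restated as products so that the field rules
     apply. *)
  change ((1 + z) / (1 + z) + ln (1 + z) * (0 + 1) +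
    ((1 - z) * - (1 - z)^-1 + ln (1 - z) * (0 - 1)) - P^`().[z] =
    ln (1 + z) - ln (1 - z) - P^`().[z]).
  have p0 : 1 + z != 0 by apply/eqP; lra.
  have m0 : 1 - z != 0 by apply/eqP; lra.
  by rewrite mulrN !divff//; ring.
- by move=> z zx; rewrite subr_ge0 S1.
Qed.

(** Both sides are even, which handles negative x; the endpoint 1, where ln (1 - x) is singular, is
    reached as a limit from the left. *)
Lemma entropy_poly_le N x : `|x| <= 1 ->
  (entropy_poly N).[x] <= (1 + x) * ln (1 + x) + (1 - x) * ln (1 - x).
Proof.
wlog x0 : x / 0 <= x => [IH|].
  move=> x1; have [/IH->//|/ltW x0] := leP 0 x.
  have := IH (- x); rewrite oppr_ge0 normrN => /(_ x0 x1).
  rewrite opprK [leRHS]addrC; apply: le_trans.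
  rewrite !horner_entropy_poly le_eqVlt; apply/orP; left; apply/eqP.
  by apply: eq_bigr => k _; rewrite !exprM sqrrN.
rewrite ger0_norm// le_eqVlt => /predU1P[->|x1]; last first.
  by apply: entropy_poly_lt1; rewrite x0.
rewrite subrr mul0r addr0.
have le2 y : 0 <= y < 1 -> (entropy_poly N).[y] <= (1 + 1) * ln (1 + 1).
  move=> /andP[y0 y1]; apply: le_trans (entropy_poly_lt1 N _) _.
    by rewrite y0.
  rewrite -[leRHS]addr0 lerD//.
    by rewrite ler_pM// ?ln_ge0 ?ler_ln ?posrE; lra.
  by rewrite mulr_ge0_le0 ?subr_ge0 ?(ltW y1)// ln_le0// lerBlDr lerDl.
have cP : (entropy_poly N).[y] @[y --> 1^'-] --> (entropy_poly N).[1].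
  apply: cvg_at_left_filter; exact: continuous_horner.
apply: (cvgr_to_le cP); near=> y; apply: le2.
by apply/andP; split; near: y; [exact: nbhs_left_ge|exact: nbhs_left_lt].
Unshelve. all: by end_near. Qed.

Lemma nat_entropy_le N x : `|x| <= 1 ->
  nat_entropy x <= ln 2 - 2^-1 * (entropy_poly N).[x].
Proof.
move=> x1.
have l2 s : 0 <= s -> s / 2 * ln (s / 2) = s / 2 * (ln s - ln 2) :> R.
  rewrite le_eqVlt => /predU1P[<-|s0]; first by rewrite !mul0r.
  by rewrite ln_div ?posrE.
have := entropy_poly_le N x1.
move: x1; rewrite ler_norml => /andP[? ?].
rewrite /nat_entropy sum_F2 !bernE !l2; lra.
Qed.

End binary_entropy_series.

(** * Densities and product measures *)

Lemma measurable_invr {R : realType} :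
  measurable_fun [set: R] (fun x : R => x^-1).
Proof.
(* Writing 1/x as x / x^2 with x^2 = exp (ln (x^2)) exhibits a composition of measurable maps; at 0
   both expressions are 0. *)
rewrite (_ : (fun x => x^-1) = fun x : R => x * expR (- ln (x ^+ 2))).
  apply: measurable_funM => //; apply: measurableT_comp => //.
  apply: measurableT_comp => //; apply: measurableT_comp => //.
apply/funext => x; have [->|x0] := eqVneq x 0; first by rewrite invr0 mul0r.
rewrite expRN lnK ?posrE ?exprn_even_gt0//.
by rewrite expr2 invfM mulrA divff// mul1r.
Qed.

Section density.
Context {R : realType} {d} {T : measurableType d}.

Lemma density_measure (mu : {measure set T -> \bar R}) (f : T -> R) :
  measurable_fun [set: T] f -> (forall x, 0 <= f x) ->
  exists nu : {measure set T -> \bar R},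
    (nu : set T -> \bar R) = fun B => (\int[mu]_(x in B) (f x)%:E)%E.
Proof.
move=> mf f0; pose nu B := (\int[mu]_(x in B) (f x)%:E)%E.
have nu0 : nu set0 = 0%E by rewrite /nu integral_set0.
have nu_ge0 B : (0 <= nu B)%E.
  by apply: integral_ge0 => x _; rewrite lee_fin.
have nuS : semi_sigma_additive nu.
  apply: semi_sigma_additive_nng_induced; last by move=> x; rewrite lee_fin.
  exact/measurable_EFinP.
pose mN := isMeasure.Build _ _ _ nu nu0 nu_ge0 nuS.
pose nuM : {measure set T -> \bar R} := HB.pack nu mN.
by exists nuM.
Qed.

Lemma probability_of_measure (nu : {measure set T -> \bar R}) :
  nu [set: T] = 1%E ->
  exists P : probability T R, (P : set T -> \bar R) = nu.
Proof.
move=> nu1; exists (mnormalize nu \d_point).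
by apply/funext => B; rewrite /= /mnormalize nu1 /= onee_eq0 /= invr1 mule1.
Qed.

Variables (mu : {sigma_finite_measure set T -> \bar R}) (nu : probability T R).
Variable f : T -> R.
Hypotheses (mf : measurable_fun [set: T] f) (f0 : forall x, 0 <= f x).
Hypothesis nuE : forall B, measurable B ->
  nu B = (\int[mu]_(x in B) (f x)%:E)%E.

(** f agrees mu-almost everywhere with the Radon-Nikodym derivative of nu, for which the change of
    variables is known. *)
Lemma ge0_integral_density (D : set T) (F : T -> \bar R) : measurable D ->
  measurable_fun [set: T] F -> (forall x, 0 <= F x)%E ->
  (\int[nu]_(x in D) F x = \int[mu]_(x in D) (F x * (f x)%:E))%E.
Proof.
move=> mD mF F0.
have numu : nu `<< mu.
  apply/null_content_dominatesP => A mA muA; rewrite nuE// null_set_integral//.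
  exact/measurable_EFinP/measurable_funTS.
rewrite -(Radon_Nikodym_SigmaFinite.change_of_variables numu)//; last first.
  exact: measurable_funTS.
have mRN := Radon_Nikodym_SigmaFinite.f_integrable numu.
apply: ae_eq_integral => //.
- apply: emeasurable_funM; apply: measurable_funTS => //.
  exact: measurable_int mRN.
- by apply: emeasurable_funM; apply: measurable_funTS => //; exact/measurable_EFinP.
- apply: ae_eqe_mul2l.
  apply: integral_ae_eq => //.
  + exact: integrableS mRN.
  + exact/measurable_EFinP/measurable_funTS.
  + move=> E ED mE; rewrite -nuE//.
    by rewrite [RHS](Radon_Nikodym_SigmaFinite.f_integral numu).
Qed.

Lemma Rintegral_density (F : T -> R) : measurable_fun [set: T] F ->
  \int[mu]_x (F x * f x) = \int[nu]_x F x.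
Proof.
move=> mF; have mFE : measurable_fun setT (EFin \o F) by exact/measurable_EFinP.
rewrite /Rintegral integralE [in RHS]integralE; congr (fine (_ - _)%E).
- rewrite ge0_integral_density//; last exact: measurable_funepos.
  apply: eq_integral => x _; rewrite !funeposE /= -!EFin_max.
  by rewrite -EFinM maxr_pMl// mul0r.
- rewrite ge0_integral_density//; last exact: measurable_funeneg.
  apply: eq_integral => x _; rewrite !funenegE /= -!EFin_max.
  by rewrite -EFinM maxr_pMl// mul0r mulNr.
Qed.

End density.

(** * Measures on tuples are determined by rectangles *)

Section tuple_rectangles.
Context {R : realType} {d} {T : measurableType d} {n : nat}.

Definition rectangle (B : 'I_n -> set T) : set (n.-tuple T) :=
  [set u | forall i, B i (tnth u i)].

Definition rectangles : set (set (n.-tuple T)) :=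
  [set A | exists2 B, (forall i, measurable (B i)) & A = rectangle B].

Lemma measurable_rectangle B : (forall i, measurable (B i)) ->
  measurable (rectangle B).
Proof.
move=> mB.
rewrite (_ : rectangle B = \bigcap_(i in [set: 'I_n]) ((@tnth n T)^~ i @^-1` B i)).
  apply: fin_bigcap_measurable => // i _; rewrite -[X in measurable X]setTI.
  exact: (measurable_tnth i).
by apply/seteqP; split => [u Bu i _|u Bu i]; [exact: Bu|exact: Bu].
Qed.

Lemma measurable_tuple_rectangles :
  @measurable _ (n.-tuple T) = <<s rectangles >>.
Proof.
apply/seteqP; split; last first.
  apply: smallest_sub; first exact: sigma_algebra_measurable.
  by move=> _ [B mB ->]; exact: measurable_rectangle.
(* Measurability of the identity out of the generated sigma-algebra is the inclusion sought; it can
   be tested on coordinates, whose preimages are rectangles with all other sides full. *)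
pose id' : g_sigma_algebraType rectangles -> n.-tuple T := id.
have mid : measurable_fun setT id'.
  apply/measurable_fun_tnthP => i _ A mA; rewrite setTI.
  apply: sub_sigma_algebra.
  exists (fun j => if j == i then A else setT) => [j|]; first by case: ifP.
  apply/seteqP; split => u /=.
    by move=> Au j; case: eqP => [->|].
  by move=> /(_ i); rewrite eqxx.
by move=> A mA; have := mid measurableT A mA; rewrite setTI.
Qed.

Lemma tuple_measure_unique (m1 m2 : {measure set (n.-tuple T) -> \bar R}) :
  (m1 setT < +oo)%E ->
  (forall B, (forall i, measurable (B i)) ->
    m1 (rectangle B) = m2 (rectangle B)) ->
  forall A, measurable A -> m1 A = m2 A.
Proof.
move=> m1y m12; apply: (measure_unique rectangles (fun=> setT)) => //.
- exact: measurable_tuple_rectangles.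
- move=> _ _ [B mB ->] [B' mB' ->]; exists (fun i => B i `&` B' i).
    by move=> i; exact: measurableI.
  apply/seteqP; split => u /= => [[Bu B'u] i|BB'].
    by split; [exact: Bu|exact: B'u].
  by split=> i; have [] := BB' i.
- move=> _; exists (fun=> setT) => //.
  by apply/seteqP; split.
- by rewrite bigcup_const.
- by move=> _ [B mB ->]; exact: m12.
Qed.

End tuple_rectangles.

Section product_probability.
Context {R : realType} {d} {T : measurableType d} (nu : probability T R).
Local Open Scope ereal_scope.

Lemma measurable_prod_tnth n (f : 'I_n -> T -> R) :
  (forall i, measurable_fun [set: T] (f i)) ->
  measurable_fun [set: n.-tuple T] (fun u => \prod_(i < n) f i (tnth u i))%R.
Proof.
move=> mf; apply: measurable_prod => i _.
by apply: measurableT_comp => //; exact: measurable_tnth.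
Qed.

(** Phrased with nonnegative functions instead of sets, the form in which independence is applied to
    densities and moments. *)
Definition is_product_law n (M : probability (n.-tuple T) R) : Prop :=
  forall f : 'I_n -> T -> R, (forall i, measurable_fun [set: T] (f i)) ->
    (forall i x, (0 <= f i x)%R) ->
    \int[M]_u (\prod_(i < n) f i (tnth u i))%:E =
    \prod_(i < n) \int[nu]_x (f i x)%:E.

(** Coordinates are added one at a time by pushing [nu \x M] along cons; Tonelli's theorem splits
    off the new factor. *)
Lemma exists_product_law n : exists M : probability (n.-tuple T) R,
  is_product_law M.
Proof.
elim: n => [|n [M IH]].
  exists (dirac [tuple]) => f mf f0; rewrite big_ord0.
  under eq_integral do rewrite big_ord0.
  by rewrite integral_cst//= diracT mul1e.
pose g (z : T * n.-tuple T) : n.+1.-tuple T := [tuple of z.1 :: z.2].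
have mg : measurable_fun [set: T * n.-tuple T] g by exact: measurable_cons.
have [M' M'E] : exists M' : probability (n.+1.-tuple T) R,
    (M' : set _ -> \bar R) = pushforward (nu \x M) g.
  pose mgM := isMeasurableFun.Build _ _ _ _ _ mg.
  pose gm : {mfun _ >-> _} := HB.pack g mgM.
  by exists (distribution (nu \x M) gm).
exists M' => f mf f0; rewrite M'E ge0_integral_pushforward//; last 2 first.
- by apply/measurable_EFinP; exact: measurable_prod_tnth.
- by move=> u _; rewrite lee_fin prodr_ge0.
rewrite preimage_setT fubini_tonelli1; last 2 first.
- apply: measurableT_comp mg; apply/measurable_EFinP.
  exact: measurable_prod_tnth.
- by move=> z; rewrite lee_fin prodr_ge0.
rewrite big_ord_recl -IH//.
transitivity (\int[nu]_x ((f ord0 x)%:E *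
    \int[M]_u (\prod_(i < n) f (lift ord0 i) (tnth u i))%:E)).
  apply: eq_integral => x _; rewrite /fubini_F /=.
  rewrite -ge0_integralZl//=.
  - apply: eq_integral => u _; rewrite -EFinM big_ord_recl tnth0.
    congr (_ * _)%:E.
    by apply: eq_bigr => i _; rewrite tnthS.
  - apply/measurable_EFinP.
    exact: (measurable_prod_tnth (f := fun i => f (lift ord0 i))).
  - by move=> u _; rewrite lee_fin prodr_ge0.
  - by rewrite lee_fin.
rewrite ge0_integralZr//.
- exact/measurable_EFinP.
- by move=> x _; rewrite lee_fin.
- by apply: integral_ge0 => u _; rewrite lee_fin prodr_ge0.
Qed.

End product_probability.

(** * The channel in normal form *)

Lemma pushforward_probability {R : realType} d d' (S : measurableType d)
    (U : measurableType d') (P : probability S R) (Y : S -> U) :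
  measurable_fun [set: S] Y ->
  exists PY : probability U R, (PY : set U -> \bar R) = pushforward P Y.
Proof.
move=> mY; pose mYM := isMeasurableFun.Build _ _ _ _ _ mY.
pose Ym : {mfun _ >-> _} := HB.pack Y mYM.
by exists (distribution P Ym).
Qed.

Lemma pushforward_measure {R : realType} d d' (S : measurableType d)
    (U : measurableType d') (m : {measure set S -> \bar R}) (Y : S -> U) :
  measurable_fun [set: S] Y ->
  exists M : {measure set U -> \bar R}, (M : set U -> \bar R) = pushforward m Y.
Proof.
move=> mY.
by exists
  (measure_function_pushforward__canonical__measure_function_Measure m mY).
Qed.

Section measurability.
Context {R : realType}.

Lemma measurable_fun_ereal d (S : measurableType d) (f : \bar R -> S) :
  measurable_fun [set: R] (fun r => f r%:E) -> measurable_fun [set: \bar R] f.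
Proof.
move=> mf.
rewrite (_ : f = fun x => if x == +oo%E then f +oo%E else
    if x == -oo%E then f -oo%E else f (fine x)%:E); last first.
  by apply/funext => -[].
have mx y : measurable_fun [set: \bar R] (fun x => x == y).
  exact: measurable_fun_eqe.
apply: measurable_fun_ifT => //; apply: measurable_fun_ifT => //.
exact: (measurableT_comp mf).
Qed.

Lemma measurable_tanh : measurable_fun [set: R] (@tanh R).
Proof.
apply: measurable_funM.
  apply: measurable_funB => //; exact: measurableT_comp.
apply: (measurableT_comp (@measurable_invr R)).
apply: measurable_funD => //; exact: measurableT_comp.
Qed.

Lemma measurable_bern x : measurable_fun [set: R] (fun t : R => bern t x).
Proof.
by apply: measurable_funM => //; apply: measurable_funD => //;
  exact: measurable_funM.
Qed.

Lemma measurable_nat_entropy : measurable_fun [set: R] (@nat_entropy R).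
Proof.
have mb x := measurable_bern x.
apply: measurableT_comp => //; apply: measurable_sum => x.
by apply: measurable_funM => //; apply: measurableT_comp.
Qed.

End measurability.

Section bounded.
Context {R : realType}.

Lemma integrable_bounded d (S : measurableType d) (P : probability S R)
    (f : S -> R) (K : R) :
  measurable_fun [set: S] f -> (forall x, `|f x| <= K) ->
  P.-integrable [set: S] (EFin \o f).
Proof.
move=> mf fK; apply: measurable_bounded_integrable => //.
  by rewrite (le_lt_trans (probability_le1 P measurableT))// ltry.
exists K; split; first exact: num_real.
by move=> M KM x _ /=; apply: le_trans (fK x) (ltW KM).
Qed.

Lemma integral_cst_probability d (S : measurableType d) (P : probability S R)
    (r : R) : (\int[P]_x (cst r%:E x) = r%:E)%E.
Proof.
rewrite (integral_cst P measurableT r%:E).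
have -> // : (r%:E * P setT = r%:E)%E.
by rewrite probability_setT mule1.
Qed.

Lemma Rintegral_cst_probability d (S : measurableType d) (P : probability S R)
    (r : R) : \int[P]_x (cst r x) = r.
Proof. by rewrite /Rintegral integral_cst_probability. Qed.

Lemma integrable_Rsum d (S : measurableType d) (P : {measure set S -> \bar R})
    (I : Type) (r : seq I) (Q : pred I) (f : I -> S -> R) :
  (forall i, P.-integrable [set: S] (EFin \o f i)) ->
  P.-integrable [set: S] (EFin \o (fun x => \sum_(i <- r | Q i) f i x)).
Proof.
move=> intf; rewrite (_ : _ \o _ = fun x => (\sum_(i <- r | Q i) (f i x)%:E)%E).
  by apply: (integrable_sum measurableT) => i _; exact: intf.
by apply/funext => x /=; rewrite sumEFin.
Qed.

Lemma Rintegral_sum d (S : measurableType d) (P : {measure set S -> \bar R})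
    (I : Type) (r : seq I) (f : I -> S -> R) :
  (forall i, P.-integrable [set: S] (EFin \o f i)) ->
  \int[P]_x (\sum_(i <- r) f i x) = \sum_(i <- r) \int[P]_x f i x.
Proof.
move=> intf; rewrite /Rintegral.
under eq_integral do rewrite -sumEFin.
rewrite (integral_sum measurableT intf) sum_fine// => i _.
exact: (integrable_fin_num measurableT (intf i)).
Qed.

Lemma bern_ln_bound (t : R) x : `|t| <= 1 ->
  -1 <= bern t x * ln (bern t x) <= 0.
Proof. by move=> t1; rewrite xlnx_bound// bern_ge0// bern_le1. Qed.

Lemma nat_entropy_ge0 (t : R) : `|t| <= 1 -> 0 <= nat_entropy t.
Proof.
move=> t1; rewrite /nat_entropy -sumrN sumr_ge0// => x _.
by rewrite oppr_ge0; have /andP[] := bern_ln_bound x t1.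
Qed.

Lemma nat_entropy_bound (t : R) : `|t| <= 1 -> `|nat_entropy t| <= 2.
Proof.
move=> t1; rewrite ger0_norm ?nat_entropy_ge0// /nat_entropy sum_F2.
have /andP[? _] := bern_ln_bound 0 t1; have /andP[? _] := bern_ln_bound 1 t1.
lra.
Qed.

End bounded.

Section channel.
Context {R : realType} {d} {T : measurableType d}.
Variables (mu : {sigma_finite_measure set T -> \bar R}) (p : 'F_2 -> T -> R).
Hypothesis Hp : MBIOS mu p.

(* With the mean density [mean_density] as reference, the two conditional      *)
(* densities are [1 + bias] and [1 - bias]; [bias = tanh (llr / 2)].           *)
Definition mean_density y : R := (p 0 y + p 1 y) / 2.

Definition bias y : R := (p 0 y - p 1 y) / (p 0 y + p 1 y).

Let p0 x y : 0 <= p x y. Proof. exact: (density_ge0 Hp). Qed.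

(** Where both densities vanish, the factor [mean_density] is 0 and the value of [bias] is
    immaterial. *)
Lemma densityE x y : p x y = 2 * bern (bias y) x * mean_density y.
Proof.
have [s0|s0] := eqVneq (p 0 y + p 1 y) 0.
  have [p0y p1y] : p 0 y = 0 /\ p 1 y = 0.
    by have := p0 0 y; have := p0 1 y; split; lra.
  rewrite /mean_density s0 mul0r mulr0.
  by case: (F2P x) => ->.
by case: (F2P x) => ->; rewrite bernE /bias /mean_density; field.
Qed.

Lemma bias_le1 y : `|bias y| <= 1.
Proof.
have [s0|s0] := eqVneq (p 0 y + p 1 y) 0.
  by rewrite /bias s0 invr0 mulr0 normr0.
have := p0 0 y; have := p0 1 y => ? ?.
have {}s0 : 0 < p 0 y + p 1 y by rewrite lt0r s0 addr_ge0.
by rewrite normrM normfV (gtr0_norm s0) ler_pdivrMr// mul1r ler_norml; lra.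
Qed.

Lemma mean_density_ge0 y : 0 <= mean_density y.
Proof. by rewrite divr_ge0// addr_ge0. Qed.

Lemma measurable_mean_density : measurable_fun [set: T] mean_density.
Proof.
apply: measurable_funM => //.
by apply: measurable_funD; exact: (density_meas Hp).
Qed.

Lemma measurable_bias : measurable_fun [set: T] bias.
Proof.
have m0 := density_meas Hp 0; have m1 := density_meas Hp 1.
apply: measurable_funM; first exact: measurable_funB.
by apply: (measurableT_comp measurable_invr); exact: measurable_funD.
Qed.

Lemma mean_law : exists nu : probability T R,
  forall B, measurable B -> nu B = (\int[mu]_(y in B) (mean_density y)%:E)%E.
Proof.
have [nu nuE] := density_measure mu measurable_mean_density mean_density_ge0.
have nu1 : nu [set: T] = 1%E.
  rewrite nuE; under eq_integral do rewrite /mean_density mulrC EFinM EFinD.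
  rewrite ge0_integralZl//; last 2 first.
  - apply: emeasurable_funD; apply/measurable_EFinP; exact: (density_meas Hp).
  - by move=> y _; rewrite -EFinD lee_fin addr_ge0.
  rewrite ge0_integralD//; last 4 first.
  - by move=> y _; rewrite lee_fin.
  - by apply/measurable_EFinP; exact: (density_meas Hp).
  - by move=> y _; rewrite lee_fin.
  - by apply/measurable_EFinP; exact: (density_meas Hp).
  rewrite !(density_int1 Hp) -EFinD -EFinM; congr _%:E; lra.
have [nuP nuPE] := probability_of_measure nu1.
by exists nuP => B _; rewrite nuPE nuE.
Qed.

Variable nu : probability T R.
Hypothesis nuE : forall B, measurable B ->
  nu B = (\int[mu]_(y in B) (mean_density y)%:E)%E.

Lemma integral_mean_law D (F : T -> \bar R) : measurable D ->
  measurable_fun [set: T] F -> (forall y, 0 <= F y)%E ->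
  (\int[nu]_(y in D) F y = \int[mu]_(y in D) (F y * (mean_density y)%:E))%E.
Proof.
exact: (ge0_integral_density measurable_mean_density nuE).
Qed.

Lemma output_lawE x B : measurable B ->
  output_law mu p x B = (\int[nu]_(y in B) (2 * bern (bias y) x)%:E)%E.
Proof.
move=> mB; rewrite integral_mean_law//.
- by apply: eq_integral => y _; rewrite -EFinM -densityE.
- apply/measurable_EFinP; apply: measurable_funM => //.
  exact: (measurableT_comp (measurable_bern x) measurable_bias).
- by move=> y; rewrite lee_fin mulr_ge0// bern_ge0// bias_le1.
Qed.

(** The involution exchanges [p 0] and [p 1]: it fixes their mean and negates their difference. *)
Lemma output_involution : exists s : T -> T,
  [/\ measurable_fun [set: T] s,
      forall B, measurable B -> nu (s @^-1` B) = nu B &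
      forall y, bias (s y) = - bias y].
Proof.
have [s [ms sK smu ps]] := output_symmetric Hp.
have ps1 y : p 1 y = p 0 (s y) by rewrite ps sK.
exists s; split => // [B mB|y].
- have msB : measurable (s @^-1` B).
    by rewrite -[X in measurable X]setTI; exact: ms.
  rewrite !nuE//.
  have [M ME] := pushforward_measure mu ms.
  transitivity (\int[M]_(y in B) (mean_density y)%:E)%E; last first.
    by apply: eq_measure_integral => A mA _; rewrite ME; exact: smu.
  rewrite ME ge0_integral_pushforward//.
  + apply: eq_integral => y _ /=.
    by rewrite /mean_density -ps1 -ps addrC.
  + by apply/measurable_EFinP/measurable_funTS; exact: measurable_mean_density.
  + by move=> y _; rewrite lee_fin mean_density_ge0.
- by rewrite /bias -ps1 -ps -mulNr opprB [p 1 y + p 0 y]addrC.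
Qed.

(** Relative to nu the density ratio in the capacity is 2 [bern]; taking the 2 out of the logarithm
    gives the 1, and the rest is minus the binary entropy. *)
Lemma capacityE :
  capacity mu p = 1 - (\int[nu]_y (nat_entropy (bias y))) / ln 2.
Proof.
pose phi x (b : R) := 2 * bern b x * log2 (2 * bern b x).
have mb x : measurable_fun [set: R] (fun b : R => bern b x).
  exact: measurable_bern.
have mphi x : measurable_fun setT (phi x \o bias).
  apply: (measurableT_comp _ measurable_bias).
  apply: measurable_funM; first exact: measurable_funM.
  apply: measurable_funM => //; apply: measurableT_comp => //.
  exact: measurable_funM.
have ln20 : 0 < ln 2 :> R by rewrite ln_gt0// ltr1n.
have phiE x b : `|b| <= 1 ->
    phi x b = 2 * bern b x + 2 * (bern b x * ln (bern b x)) / ln 2.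
  move=> b1; rewrite /phi /log2.
  have := bern_ge0 x b1; rewrite le_eqVlt => /predU1P[<-|b0].
    by rewrite !(mulr0, mul0r) addr0.
  by rewrite lnM ?posrE//; field; rewrite gt_eqF.
have iphi x : nu.-integrable setT (EFin \o (phi x \o bias)).
  apply: (@integrable_bounded _ _ _ _ _ (2 + 2 / ln 2)) => // y /=.
  have b1 := bias_le1 y; have bx0 := bern_ge0 x b1; have bx1 := bern_le1 x b1.
  have /andP[l1 l0] := bern_ln_bound x b1.
  rewrite phiE// (le_trans (ler_normD _ _))// lerD//.
    by rewrite ger0_norm; lra.
  by rewrite normrM normfV (gtr0_norm ln20) ler_pM2r ?invr_gt0// ler_norml; lra.
have phi_int x :
    \int[mu]_y (p x y * log2 (p x y / (2^-1 * \sum_(x' : 'F_2) p x' y))) =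
    \int[nu]_y phi x (bias y).
  rewrite -(Rintegral_density measurable_mean_density mean_density_ge0 nuE (mphi x)).
  apply: eq_Rintegral => y _; rewrite sum_F2 -/(mean_density y) [2^-1 * _]mulrC.
  rewrite -/(mean_density y) {1 2}densityE /phi.
  have [->|w0] := eqVneq (mean_density y) 0; first by rewrite !mulr0 mul0r.
  by rewrite mulfK// mulrAC.
transitivity (\sum_(x : 'F_2) 2^-1 * \int[nu]_y phi x (bias y)).
  by apply: eq_bigr => x _; rewrite phi_int.
rewrite sum_F2 -(RintegralZl _ measurableT (iphi 0)).
rewrite -(RintegralZl _ measurableT (iphi 1)).
rewrite -RintegralD//; last 2 first.
- exact: (integrableZl measurableT 2^-1 (iphi 0)).
- exact: (integrableZl measurableT 2^-1 (iphi 1)).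
have ih : nu.-integrable setT (EFin \o (@nat_entropy R \o bias)).
  apply: (@integrable_bounded _ _ _ _ _ 2) => [|y].
    exact: (measurableT_comp measurable_nat_entropy measurable_bias).
  exact/nat_entropy_bound/bias_le1.
rewrite -RintegralZr//.
rewrite [X in _ = X - _](_ : 1 = \int[nu]_y (cst 1 y)); last first.
  by rewrite Rintegral_cst_probability.
rewrite -RintegralB//; last 2 first.
- by apply: (@integrable_bounded _ _ _ _ _ `|1|) => // y.
- exact: (integrableZr measurableT (ln 2)^-1 ih).
apply: eq_Rintegral => y _; have b1 := bias_le1 y.
rewrite /= !phiE// /nat_entropy sum_F2 !bernE /cst.
by field; rewrite gt_eqF.
Qed.

(** When both densities vanish the quotient is 0 * +oo = 0, so the LLR is -oo and such outputs fall
    outside the domain of [g_]. *)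
Lemma llrE y : llr p y =
  if p 1 y == 0 then (if p 0 y == 0 then -oo%E else +oo%E)
  else if p 0 y == 0 then -oo%E else (ln (p 0 y / p 1 y))%:E.
Proof.
rewrite /llr inver; case: ifPn => [_|p1y].
  have [->|p0y] := eqVneq (p 0 y) 0; first by rewrite mul0e /= lexx.
  by rewrite gt0_muley// lte_fin lt0r p0y p0.
rewrite -EFinM; have [->|p0y] := eqVneq (p 0 y) 0.
  by rewrite mul0r /= lexx.
by rewrite lne_EFin// divr_gt0// lt0r ?p0y ?p1y p0.
Qed.

Lemma measurable_llr : measurable_fun [set: T] (llr p).
Proof.
have m0 := density_meas Hp 0; have m1 := density_meas Hp 1.
rewrite (_ : llr p = fun y => if p 1 y == 0
  then (if p 0 y == 0 then -oo%E else +oo%E)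
  else if p 0 y == 0 then -oo%E else (ln (p 0 y / p 1 y))%:E); last first.
  by apply/funext => y; exact: llrE.
have mz x : measurable_fun setT (fun y => p x y == 0).
  by apply: measurable_fun_eqr => //; exact: (density_meas Hp x).
apply: measurable_fun_ifT => //; apply: measurable_fun_ifT => //.
apply/measurable_EFinP; apply: measurableT_comp => //.
by apply: measurable_funM => //; exact: (measurableT_comp measurable_invr).
Qed.

Lemma tanh_half_ln (q : R) : 0 < q -> tanh (ln q * 2^-1) = (q - 1) / (q + 1).
Proof.
move=> q0; rewrite /tanh expRN; set e := expR _.
have e0 : 0 < e by exact: expR_gt0.
have -> : q = e * e by rewrite -expRD -splitr lnK.
by field; repeat (apply/andP; split); nra.
Qed.

Let llr_weight k (l : \bar R) : \bar R :=
  ((1 + expeR (- l)) * (tanhe (l * 2^-1%:E) ^+ (2 * k))%R%:E)%E.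

Let positive_part k (b : R) : R := if 0 < b then b ^+ (2 * k) else 0.

Let measurable_llr_weight k : measurable_fun [set: \bar R] (llr_weight k).
Proof.
apply: measurable_fun_ereal; rewrite /llr_weight /=.
apply: emeasurable_funM.
  apply/measurable_EFinP; apply: measurable_funD => //.
  by apply: measurableT_comp => //; exact: measurableT_comp.
apply/measurable_EFinP; apply: measurable_funX.
by apply: (measurableT_comp measurable_tanh); exact: measurable_funM.
Qed.

Let llr_weight_ge0 k l : (0 <= llr_weight k l)%E.
Proof.
by rewrite mule_ge0 ?adde_ge0 ?expeR_ge0// lee_fin exprn_even_ge0// oddM.
Qed.

(** Since exp (- l) = p(y|1) / p(y|0), the factor 1 + exp (- l) turns [p 0] into [p 0 + p 1], twice
    the mean density, while tanh (l/2) is the bias. An infinite LLR corresponds to bias 1. *)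
Let llr_weight_density k y : (0 < k)%N ->
  ((fun y => llr_weight k (llr p y) * (p 0 y)%:E)%E \_
    (llr p @^-1` [set l | 0 <= l]%E)) y =
  ((2 * positive_part k (bias y))%:E * (mean_density y)%:E)%E.
Proof.
move=> k0; rewrite /patch.
have -> : (y \in llr p @^-1` [set l | 0 <= l]%E) = (0 <= llr p y)%E.
  by apply/idP/idP; rewrite inE.
rewrite llrE /llr_weight /positive_part /bias /mean_density.
have := p0 0 y; have := p0 1 y; rewrite !le0r.
have [->|p1y] /= := eqVneq (p 1 y) 0 => p1p.
  have [->|p0y] /= := eqVneq (p 0 y) 0 => p0p.
    by rewrite subrr mul0r ltxx !mulr0 mul0e.
  rewrite leey subr0 !addr0.
  rewrite divff// ltr01 gt0_mulye ?lte_fin ?invr_gt0//.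
  rewrite /= !expr1n !mul1e -EFinM; congr _%:E; lra.
have [->|p0y] /= := eqVneq (p 0 y) 0 => p0p.
  rewrite sub0r add0r mulNr divff// oppr_gt0 ltr10.
  by rewrite mulr0 mul0e.
set a := p 0 y in p0p p0y *; set b := p 1 y in p1p p1y *.
have ab0 : 0 < a + b by rewrite addr_gt0.
have q0 : 0 < a / b by rewrite divr_gt0.
have tE : tanh (ln (a / b) * 2^-1) = (a - b) / (a + b).
  by rewrite tanh_half_ln//; field; repeat (apply/andP; split); lra.
rewrite tE expRN lnK ?posrE// lee_fin pmulr_lgt0 ?invr_gt0// subr_gt0.
have [ab|ba|ab] := ltgtP b a.
- rewrite ln_ge0 ?ler_pdivlMr ?mul1r ?(ltW ab)//.
  rewrite -[(1 + _)%E]/((1 + (a / b)^-1)%:E) -!EFinM.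
  by congr _%:E; field; repeat (apply/andP; split); lra.
- rewrite ifN ?mulr0 ?mul0e// -ltNge ln_lt0// q0 /=.
  by rewrite ltr_pdivrMr// mul1r.
(* At l = 0 the bias is 0, and k > 0 makes both sides vanish. *)
- rewrite ab subrr mul0r expr0n muln_eq0 /= -leqn0 leqNgt k0 mulr0 !mul0e.
  by rewrite mule0 mul0e if_same.
Qed.

(** The integral over l >= 0 is twice the moment over positive biases; by symmetry one of the two
    copies accounts for the negative biases. *)
Lemma gE k : (0 < k)%N ->
  g_ mu p k = \int[nu]_y (bias y ^+ (2 * k)).
Proof.
move=> k0.
have [rho' rho'E] := density_measure mu (density_meas Hp 0) (p0 0).
have [|rho rhoE] := probability_of_measure (nu := rho').
  by rewrite rho'E (density_int1 Hp).
have {}rhoE : (rho : set T -> \bar R) = output_law mu p 0 by rewrite rhoE rho'E.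
pose D := [set l : \bar R | 0 <= l]%E.
have mD : measurable D.
  rewrite -[D]setTI.
  exact: (emeasurable_fun_c_infty measurableT (@measurable_id _ _ setT)).
have mlD : measurable (llr p @^-1` D).
  by rewrite -[X in measurable X]setTI; exact: measurable_llr.
have mpp : measurable_fun setT (positive_part k \o bias).
  apply: (measurableT_comp _ measurable_bias).
  by apply: measurable_fun_ifT => //; exact: measurable_fun_ltr.
have pp0 b : 0 <= positive_part k b.
  by rewrite /positive_part; case: ifP => // b0; rewrite exprn_ge0 ?ltW.
have -> : g_ mu p k = \int[nu]_y (2 * positive_part k (bias y)).
  rewrite /g_ -[LHS]/(fine (\int[llr_law mu p]_(l in D) llr_weight k l)%E).
  congr fine; rewrite /llr_law -rhoE ge0_integral_pushforward//; last 2 first.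
  - exact: measurable_llr.
  - exact: measurable_funTS.
  have rhod B : measurable B -> rho B = (\int[mu]_(y in B) (p 0 y)%:E)%E.
    by move=> _; rewrite rhoE.
  rewrite (ge0_integral_density (density_meas Hp 0) rhod)//; last 2 first.
  - exact: (measurableT_comp (measurable_llr_weight k) measurable_llr).
  - by move=> y; exact: llr_weight_ge0.
  rewrite [LHS]integral_mkcond integral_mean_law//; last 2 first.
  - by apply/measurable_EFinP; exact: measurable_funM.
  - by move=> y; rewrite lee_fin mulr_ge0.
  by apply: eq_integral => y _; exact: llr_weight_density.
have [s [ms snu sb]] := output_involution.
have ipp : nu.-integrable setT (EFin \o (positive_part k \o bias)).
  apply: (@integrable_bounded _ _ _ _ _ 1) => // y /=.
  rewrite /positive_part; case: ifP => _; last by rewrite normr0.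
  by rewrite normrX exprn_ile1// bias_le1.
have -> : \int[nu]_y (2 * positive_part k (bias y)) =
    \int[nu]_y (positive_part k (bias y)) +
    \int[nu]_y (positive_part k (bias (s y))).
  rewrite (RintegralZl _ measurableT ipp) mulr2n mulrDl mul1r; congr (_ + _).
  congr fine.
  have [M ME] := pushforward_measure nu ms.
  transitivity (\int[M]_y (positive_part k (bias y))%:E)%E.
    by apply: eq_measure_integral => A mA _; rewrite ME; exact/esym/snu.
  rewrite ME ge0_integral_pushforward// => [|y _]; last by rewrite lee_fin.
  exact/measurable_EFinP.
rewrite -RintegralD//; last first.
  apply: (@integrable_bounded _ _ _ _ _ 1) => [|y /=].
    exact: (measurableT_comp mpp ms).
  rewrite /positive_part; case: ifP => _; last by rewrite normr0.
  by rewrite normrX exprn_ile1// bias_le1.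
apply: eq_Rintegral => y _; rewrite sb /positive_part oppr_gt0.
have [||->] := ltgtP (bias y) 0; rewrite ?addr0 ?add0r//.
  by rewrite exprM sqrrN -exprM.
by rewrite expr0n muln_eq0 /= -leqn0 leqNgt k0.
Qed.

End channel.

(** * Conditional entropy of a coded transmission *)

Section posterior_version.
Context {R : realType} {d d' : measure_display} {Omega : measurableType d}.
Variable P : probability Omega R.
Context {A : finType} {U : measurableType d'}.
Variables (X : Omega -> A) (Y : Omega -> U).

Lemma plogpE (t : R) : plogp t = - (t * ln t) / ln 2.
Proof. by rewrite /plogp /log2 mulrA mulNr. Qed.

Lemma plogp_ge0 (t : R) : 0 <= t <= 1 -> 0 <= plogp t.
Proof.
move=> /xlnx_bound/andP[_ t0].
by rewrite plogpE divr_ge0 ?oppr_ge0// ln_ge0// ler1n.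
Qed.

Lemma measurable_plogp : measurable_fun [set: R] (@plogp R).
Proof.
apply: measurableT_comp => //; apply: measurable_funM => //.
by apply: measurable_funM.
Qed.

Lemma cond_pmf_le1 (q : A -> U -> R) a u : is_cond_pmf P X Y q -> q a u <= 1.
Proof.
move=> [_ q0 q1 _]; rewrite -(q1 u) (bigD1 a)//= lerDl.
by apply: sumr_ge0 => b _.
Qed.

Variable PY : probability U R.
Hypotheses (mY : measurable_fun [set: Omega] Y)
  (PYE : (PY : set U -> \bar R) = pushforward P Y).

Lemma integral_output_law B (f : U -> \bar R) : measurable B ->
  measurable_fun [set: U] f -> (forall u, 0 <= f u)%E ->
  (\int[PY]_(u in B) f u = \int[P]_(w in Y @^-1` B) f (Y w))%E.
Proof.
move=> mB mf f0; rewrite PYE ge0_integral_pushforward//.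
exact: measurable_funTS.
Qed.

(** For each a the two versions have equal integrals over every measurable set of outputs; finitely
    many null sets are then united. *)
Lemma cond_pmf_ae_eq (q q' : A -> U -> R) :
  is_cond_pmf P X Y q -> is_cond_pmf P X Y q' ->
  {ae PY, forall u, forall a, q a u = q' a u}.
Proof.
move=> Hq Hq'; apply: filter_forall => a.
have int_q r : is_cond_pmf P X Y r -> PY.-integrable setT (EFin \o r a).
  move=> Hr; apply: (@integrable_bounded _ _ _ _ _ 1) => [|u].
    exact: cond_pmf_meas Hr a.
  by rewrite ger0_norm ?(cond_pmf_le1 _ _ Hr)// (cond_pmf_ge0 Hr).
have := @integral_ae_eq _ _ _ PY setT measurableT (EFin \o q' a) (EFin \o q a)
  (int_q _ Hq) (measurable_int _ (int_q _ Hq')).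
case=> [E _ mE|N [mN N0 sN]].
  rewrite !integral_output_law//; last 4 first.
  - exact: measurable_int (int_q _ Hq').
  - by move=> u; rewrite lee_fin (cond_pmf_ge0 Hq').
  - exact: measurable_int (int_q _ Hq).
  - by move=> u; rewrite lee_fin (cond_pmf_ge0 Hq).
  by rewrite /= -(cond_pmfE Hq)// -(cond_pmfE Hq').
exists N; split => // u /= qq'; apply: sN => /= /(_ I) [] qe.
exact: qq'.
Qed.

Lemma cond_entropyE (q : A -> U -> R) : is_cond_pmf P X Y q ->
  cond_entropy P X Y = \int[PY]_u (\sum_(a : A) plogp (q a u)).
Proof.
(* As a version exists, the one selected by [xget] is itself a version. *)
move=> Hq; have Hc : is_cond_pmf P X Y (cond_pmf P X Y).
  by apply: xgetPex; exists q.
have mS r : is_cond_pmf P X Y r ->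
    measurable_fun setT (fun u => (\sum_(a : A) plogp (r a u))%:E).
  move=> Hr; apply/measurable_EFinP; apply: measurable_sum => a.
  by apply: (measurableT_comp measurable_plogp); exact: cond_pmf_meas Hr a.
rewrite /cond_entropy /Rintegral; congr fine.
rewrite -[LHS](integral_output_law measurableT (mS _ Hc)); last first.
  move=> u; rewrite lee_fin sumr_ge0// => a _; rewrite plogp_ge0//.
  by rewrite (cond_pmf_ge0 Hc) (cond_pmf_le1 _ _ Hc).
apply: ae_eq_integral => //; [exact: mS|exact: mS|].
have [N [mN N0 sN]] := cond_pmf_ae_eq Hc Hq.
exists N; split => // u /= qq'; apply: sN => /= qe; apply: qq' => _.
by congr _%:E; apply: eq_bigr => a _; rewrite qe.
Qed.

End posterior_version.

Section product_law.
Context {R : realType} {d} {T : measurableType d} (nu : probability T R).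
Variables (n : nat) (M : probability (n.-tuple T) R).
Hypothesis HM : is_product_law nu M.

Lemma product_law_rectangle (B : 'I_n -> set T) (f : 'I_n -> T -> R) :
  (forall i, measurable (B i)) ->
  (forall i, measurable_fun [set: T] (f i)) -> (forall i x, 0 <= f i x) ->
  (\int[M]_(u in rectangle B) (\prod_(i < n) f i (tnth u i))%:E =
   \prod_(i < n) \int[nu]_(x in B i) (f i x)%:E)%E.
Proof.
move=> mB mf f0; rewrite integral_mkcond.
pose g i x := f i x * \1_(B i) x.
have mg i : measurable_fun [set: T] (g i).
  by apply: measurable_funM => //; exact: measurable_indic.
transitivity (\int[M]_u (\prod_(i < n) g i (tnth u i))%:E)%E.
  apply: eq_integral => u _; rewrite /patch; case: ifPn => [|] /=.
    rewrite inE => uB; congr _%:E; apply: eq_bigr => i _.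
    by rewrite /g indicE mem_set ?mulr1//; exact: uB.
  rewrite notin_setE => /existsNP[i uBi].
  rewrite (bigD1 i)//= /g indicE memNset// mulr0 mul0r.
  by [].
rewrite HM// => [|i x]; last by rewrite mulr_ge0.
apply: eq_bigr => i _; rewrite [RHS]integral_mkcond.
apply: eq_integral => x _; rewrite /patch /g indicE; case: ifPn => _.
  by rewrite mulr1.
by rewrite mulr0.
Qed.

(** Coordinates outside Q receive the constant 1, whose integral is 1. *)
Lemma product_law_Rintegral (Q : pred 'I_n) (f : T -> R) :
  (forall x, 0 <= f x) -> nu.-integrable [set: T] (EFin \o f) ->
  \int[M]_u (\prod_(i < n | Q i) f (tnth u i)) =
  \prod_(i < n | Q i) \int[nu]_x f x.
Proof.
move=> f0 intf.
pose g i x := if Q i then f x else 1.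
have mf : measurable_fun setT f.
  by apply/measurable_EFinP; exact: measurable_int intf.
rewrite {1}/Rintegral.
under eq_integral => u _ do rewrite big_mkcond/=.
rewrite (@HM g); last 2 first.
- by move=> i; rewrite /g; case: (Q i).
- by move=> i x; rewrite /g; case: (Q i).
rewrite [RHS]big_mkcond /=.
rewrite (eq_bigr (fun i => (if Q i then \int[nu]_x f x else 1)%:E)); last first.
  move=> i _; rewrite /g; case: ifPn => _; last first.
    exact: integral_cst_probability.
  by rewrite /Rintegral fineK// integrable_fin_num.
by rewrite prodEFin.
Qed.

End product_law.

(** * Posterior law of the transmitted codeword *)

Section code_transmission.
Context {R : realType} {d d' : measure_display} {T : measurableType d}.
Context {Omega : measurableType d'} (P : probability Omega R) {n : nat}.
Variables (C : {vspace 'rV['F_2]_n}).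
Variables (X : Omega -> 'rV['F_2]_n) (Y : Omega -> n.-tuple T).
Variables (nu : probability T R) (t : T -> R) (M : probability (n.-tuple T) R).
Hypotheses (mt : measurable_fun [set: T] t) (t1 : forall y, `|t y| <= 1).
Hypothesis HM : is_product_law nu M.
Hypotheses (mX : forall c, measurable [set w | X w = c])
  (mY : measurable_fun [set: Omega] Y).
Hypothesis law : forall c (B : 'I_n -> set T), (forall i, measurable (B i)) ->
  P ([set w | X w = c] `&` Y @^-1` rectangle B) =
  (((c \in C)%:R / #|C|%:R)%:E *
   \prod_(i < n) \int[nu]_(y in B i) (2 * bern (t y) (c ord0 i))%:E)%E.

Definition tuple_bias (u : n.-tuple T) (i : 'I_n) : R := t (tnth u i).

Let tb1 u i : `|tuple_bias u i| <= 1. Proof. exact: t1. Qed.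

Lemma measurable_word_pmf c :
  measurable_fun [set: n.-tuple T] (fun u => word_pmf (tuple_bias u) c).
Proof.
apply: (measurable_prod_tnth (f := fun i y => bern (t y) (c ord0 i))) => i.
exact: (measurableT_comp (measurable_bern _) mt).
Qed.

Lemma measurable_coset_pmf v :
  measurable_fun [set: n.-tuple T] (fun u => coset_pmf C (tuple_bias u) v).
Proof.
rewrite /coset_pmf; under eq_fun do rewrite big_mkcond /=.
apply: measurable_sum => c; case: (c \in C) => //.
exact: measurable_word_pmf.
Qed.

Definition joint_density c u : R :=
  (c \in C)%:R / #|C|%:R * (2 ^+ n * word_pmf (tuple_bias u) c).

Lemma joint_density_ge0 c u : 0 <= joint_density c u.
Proof. by rewrite !mulr_ge0// ?word_pmf_ge0// exprn_ge0. Qed.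

Lemma measurable_joint_density c :
  measurable_fun [set: n.-tuple T] (joint_density c).
Proof.
apply: measurable_funM => //; apply: measurable_funM => //.
exact: measurable_word_pmf.
Qed.

(** Both sides are finite measures in B, and they agree on rectangles: memorylessness on one side,
    the product law on the other. *)
Lemma joint_law c B : measurable B ->
  P ([set w | X w = c] `&` Y @^-1` B) =
  (\int[M]_(u in B) (joint_density c u)%:E)%E.
Proof.
have [m1 m1E] := pushforward_measure (mrestr P (mX c)) mY.
have [m2 m2E] :=
  density_measure M (measurable_joint_density c) (joint_density_ge0 c).
move=> mB.
have <- : m1 B = P ([set w | X w = c] `&` Y @^-1` B).
  by rewrite m1E /pushforward /mrestr setIC.
transitivity (m2 B); last by rewrite m2E.
apply: tuple_measure_unique => // [|A mA].
  rewrite m1E /pushforward /mrestr (le_lt_trans (probability_le1 _ _)) ?ltry//.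
  by rewrite preimage_setT setTI.
have -> : m1 (rectangle A) = P ([set w | X w = c] `&` Y @^-1` rectangle A).
  by rewrite m1E /pushforward /mrestr setIC.
have mb i : measurable_fun setT (fun y => 2 * bern (t y) (c ord0 i)).
  apply: measurable_funM => //.
  exact: (measurableT_comp (measurable_bern _) mt).
rewrite m2E law//.
rewrite -(product_law_rectangle HM mA (f := fun i y => 2 * bern (t y) (c ord0 i))).
- rewrite -ge0_integralZl//.
  + apply: eq_integral => u _; rewrite -EFinM /joint_density; congr (_ * _)%:E.
    by rewrite big_split /= prodr_const card_ord.
  + exact: measurable_rectangle.
  + apply/measurable_EFinP/measurable_funTS.
    exact: (measurable_prod_tnth (f := fun i y => 2 * bern (t y) (c ord0 i))).
  + by move=> u _; rewrite lee_fin prodr_ge0// => i _; rewrite mulr_ge0 ?bern_ge0.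
- by [].
- by move=> i y; rewrite mulr_ge0 ?bern_ge0.
Qed.

Definition output_density u : R :=
  2 ^+ n / #|C|%:R * coset_pmf C (tuple_bias u) 0.

Lemma coset_pmf_ge0 u v : 0 <= coset_pmf C (tuple_bias u) v.
Proof. by apply: sumr_ge0 => c _; exact: word_pmf_ge0. Qed.

Lemma output_density_ge0 u : 0 <= output_density u.
Proof. by rewrite mulr_ge0 ?coset_pmf_ge0// divr_ge0// exprn_ge0. Qed.

Lemma measurable_output_density : measurable_fun [set: n.-tuple T] output_density.
Proof. by apply: measurable_funM => //; exact: measurable_coset_pmf. Qed.

Lemma sum_joint_density u : \sum_c joint_density c u = output_density u.
Proof.
rewrite /output_density /coset_pmf mulr_sumr [RHS]big_mkcond /=.
apply: eq_bigr => c _; rewrite /joint_density addr0; case: (c \in C).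
  by rewrite mul1r mulrA [_^-1 * _]mulrC.
by rewrite !mul0r.
Qed.

Lemma output_lawE_density B : measurable B ->
  P (Y @^-1` B) = (\int[M]_(u in B) (output_density u)%:E)%E.
Proof.
move=> mB.
have mYB : measurable (Y @^-1` B).
  by rewrite -[X in measurable X]setTI; exact: mY.
transitivity (\sum_c P ([set w | X w = c] `&` Y @^-1` B)).
  rewrite -[in LHS](setIid (Y @^-1` B)) -integral_indic//.
  transitivity (\int[P]_(w in Y @^-1` B) (\sum_c (\1_[set w | X w = c] w)%:E))%E.
    apply: eq_integral => w wB; rewrite indicE wB sumEFin; congr _%:E.
    rewrite (bigD1 (X w))//= indicE mem_set// big1 ?addr0// => c cX.
    by rewrite indicE memNset//= => Xc; move: cX; rewrite Xc eqxx.
  rewrite ge0_integral_sum//.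
  - by apply: eq_bigr => c _; rewrite integral_indic.
  - move=> c; apply/measurable_EFinP; apply: measurable_funTS.
    exact: measurable_indic.
under eq_bigr do rewrite joint_law//.
rewrite -ge0_integral_sum//.
- by apply: eq_integral => u _; rewrite sumEFin sum_joint_density.
- move=> c; apply/measurable_EFinP/measurable_funTS.
  exact: measurable_joint_density.
- by move=> c u _; rewrite lee_fin joint_density_ge0.
Qed.

(* Outputs with [coset_pmf = 0] have probability 0: any pmf will do there.     *)
Definition posterior c u : R :=
  if coset_pmf C (tuple_bias u) 0 == 0 then (c == 0)%:R
  else (c \in C)%:R * word_pmf (tuple_bias u) c / coset_pmf C (tuple_bias u) 0.

(** Bayes' rule; if the code has mass 0 then so does each codeword, and both sides vanish. *)
Lemma posterior_output_density c u :
  posterior c u * output_density u = joint_density c u.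
Proof.
rewrite /posterior /output_density /joint_density.
case: eqP => [c0|/eqP c0].
  rewrite c0 !mulr0; case: (boolP (c \in C)) => [cC|_]; last by rewrite !mul0r.
  have := coset_pmf_ge C c (tb1 u).
  rewrite -[c in coset_pmf _ _ c]add0r coset_pmf_shift// c0 => w0.
  have -> : word_pmf (tuple_bias u) c = 0.
    by apply/eqP; rewrite eq_le w0 word_pmf_ge0.
  by rewrite !mulr0.
have C0 : #|C|%:R != 0 :> R by rewrite pnatr_eq0 -lt0n card_code_gt0.
by field; apply/andP.
Qed.

Lemma measurable_posterior c : measurable_fun [set: n.-tuple T] (posterior c).
Proof.
apply: measurable_fun_ifT => //.
  by apply: measurable_fun_eqr => //; exact: measurable_coset_pmf.
apply: measurable_funM.
  by apply: measurable_funM => //; exact: measurable_word_pmf.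
apply: (measurableT_comp measurable_invr); exact: measurable_coset_pmf.
Qed.

Lemma posterior_ge0 c u : 0 <= posterior c u.
Proof.
rewrite /posterior; case: ifP => // _.
by rewrite divr_ge0 ?coset_pmf_ge0// mulr_ge0// word_pmf_ge0.
Qed.

Variable PY : probability (n.-tuple T) R.
Hypothesis PYE : (PY : set (n.-tuple T) -> \bar R) = pushforward P Y.

Let PY_density B : measurable B ->
  PY B = (\int[M]_(u in B) (output_density u)%:E)%E.
Proof. by move=> mB; rewrite PYE -output_lawE_density. Qed.

Lemma posterior_is_cond_pmf : is_cond_pmf P X Y posterior.
Proof.
split.
- exact: measurable_posterior.
- exact: posterior_ge0.
- move=> u; rewrite /posterior; case: eqP => [_|/eqP c0].
    by rewrite (bigD1 0)//= eqxx big1 ?addr0// => c /negbTE ->.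
  rewrite -mulr_suml -[RHS](divff c0); congr (_ / _).
  rewrite /coset_pmf [RHS]big_mkcond; apply: eq_bigr => c _.
  by rewrite addr0; case: (c \in C); rewrite ?mul1r ?mul0r.
- move=> c B mB; rewrite joint_law//.
  have mpE : measurable_fun setT (fun u => (posterior c u)%:E).
    by apply/measurable_EFinP; exact: measurable_posterior.
  rewrite -(integral_output_law mY PYE mB mpE); last first.
    by move=> u; rewrite lee_fin posterior_ge0.
  rewrite (ge0_integral_density measurable_output_density PY_density)//;
    last first.
    by move=> u; rewrite lee_fin posterior_ge0.
  by apply: eq_integral => u _; rewrite -EFinM posterior_output_density.
Qed.

Lemma measurable_code_information :
  measurable_fun [set: n.-tuple T] (fun u => code_information C (tuple_bias u)).
Proof.
rewrite /code_information; under eq_fun do rewrite big_mkcond /=.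
apply: measurable_sum => c; case: (c \in C) => //.
apply: measurable_funM; first exact: measurable_word_pmf.
apply: measurable_funB; apply: measurableT_comp => //.
  exact: measurable_coset_pmf.
exact: measurable_word_pmf.
Qed.

Lemma integrable_code_information :
  M.-integrable [set: n.-tuple T]
    (EFin \o (fun u => code_information C (tuple_bias u))).
Proof.
apply: (@integrable_bounded _ _ _ _ _ #|C|%:R).
  exact: measurable_code_information.
by move=> u; exact: code_information_bound.
Qed.

(** The output density is proportional to the mass of C, which cancels the denominator of the
    posterior. *)
Lemma posterior_information u :
  (\sum_c plogp (posterior c u)) * output_density u =
  2 ^+ n / (#|C|%:R * ln 2) * code_information C (tuple_bias u).
Proof.
have C0 : #|C|%:R != 0 :> R by rewrite pnatr_eq0 -lt0n card_code_gt0.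
have ln20 : ln 2 != 0 :> R by rewrite gt_eqF// ln_gt0// ltr1n.
rewrite /code_information mulr_suml mulr_sumr [RHS]big_mkcond.
apply: eq_bigr => c _; rewrite /posterior /output_density.
have w0 := word_pmf_ge0 c (tb1 u); have cs0 := coset_pmf_ge0 u 0.
set w := word_pmf _ _ in w0 *; set cs := coset_pmf _ _ _ in cs0 *.
have [cse|csN0] := eqVneq cs 0.
  rewrite cse !mulr0; case: ifP => // cC.
  have -> : w = 0; last by rewrite !mul0r mulr0.
  have := coset_pmf_ge C c (tb1 u).
  rewrite -[c in coset_pmf _ _ c]add0r coset_pmf_shift// -/cs cse => wle.
  by apply/eqP; rewrite eq_le w0 andbT.
rewrite plogpE; case: ifP => [cC|_]; last by rewrite !mul0r oppr0 !mul0r.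
move: w0; rewrite le_eqVlt => /predU1P[<-|w0].
  by rewrite !(mulr0, mul0r, oppr0).
rewrite mul1r ln_div ?posrE// ?lt0r ?csN0//.
by field; rewrite C0 ln20.
Qed.

Lemma cond_entropy_information :
  cond_entropy P X Y = 2 ^+ n / (#|C|%:R * ln 2) *
    \int[M]_u code_information C (tuple_bias u).
Proof.
rewrite (cond_entropyE mY PYE posterior_is_cond_pmf).
have mS : measurable_fun setT
    (fun u => \sum_(c : 'rV['F_2]_n) plogp (posterior c u)).
  apply: measurable_sum => c.
  apply: (measurableT_comp measurable_plogp); exact: measurable_posterior.
rewrite -(Rintegral_density measurable_output_density output_density_ge0
  PY_density mS).
rewrite -(RintegralZl _ measurableT integrable_code_information).
by apply: eq_Rintegral => u _; exact: posterior_information.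
Qed.

(** * Averaging over output flips *)

Section output_flip.
Variable s : T -> T.
Hypotheses (ms : measurable_fun [set: T] s)
  (nus : forall B, measurable B -> nu (s @^-1` B) = nu B)
  (ts : forall y, t (s y) = - t y).

Definition flip (v : 'rV['F_2]_n) (u : n.-tuple T) : n.-tuple T :=
  [tuple if v ord0 i == 0 then tnth u i else s (tnth u i) | i < n].

Lemma tuple_bias_flip v u :
  tuple_bias (flip v u) = fun i => sgnF2 (v ord0 i) * tuple_bias u i.
Proof.
apply/funext => i; rewrite /tuple_bias tnth_mktuple /sgnF2.
by case: ifP => _; rewrite ?mul1r// ts mulN1r.
Qed.

Lemma measurable_flip v : measurable_fun [set: n.-tuple T] (flip v).
Proof.
apply/measurable_fun_tnthP => i /=.
rewrite (_ : _ \o _ = fun u => if v ord0 i == 0 then tnth u i else s (tnth u i)).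
  case: (v ord0 i == 0); first exact: measurable_tnth.
  by apply: (measurableT_comp ms); exact: measurable_tnth.
by apply/funext => u /=; rewrite tnth_mktuple.
Qed.

Lemma product_law_cube (B : 'I_n -> set T) : (forall i, measurable (B i)) ->
  M (rectangle B) = (\prod_(i < n) nu (B i))%E.
Proof.
move=> mB; have := product_law_rectangle HM mB (f := fun _ _ => 1).
under eq_integral do rewrite big1//.
rewrite integral_cst ?mul1e; last exact: measurable_rectangle.
move=> ->//; apply: eq_bigr => i _.
by rewrite integral_cst// mul1e.
Qed.

(** A flip pulls a rectangle back to a rectangle whose sides have the same measures. *)
Lemma product_law_flip v B : measurable B -> M (flip v @^-1` B) = M B.
Proof.
have [m1 m1E] := pushforward_measure M (measurable_flip v).
move=> mB; have <- : m1 B = M (flip v @^-1` B) by rewrite m1E.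
apply: tuple_measure_unique => // [|A mA].
  rewrite m1E /pushforward preimage_setT.
  by rewrite (le_lt_trans (probability_le1 _ _)) ?ltry.
rewrite m1E /pushforward.
pose A' i := if v ord0 i == 0 then A i else s @^-1` A i.
have -> : flip v @^-1` rectangle A = rectangle A'.
  apply/seteqP; split => u /= uA i; have := uA i; rewrite /A' tnth_mktuple;
    by case: ifP.
have mA' i : measurable (A' i).
  rewrite /A'; case: ifP => // _.
  by rewrite -[X in measurable X]setTI; exact: ms.
rewrite [RHS]product_law_cube//.
transitivity (\prod_(i < n) nu (A' i))%E; first exact: product_law_cube.
by apply: eq_bigr => i _; rewrite /A'; case: ifP => // _; exact: nus.
Qed.

Lemma Rintegral_flip v (f : n.-tuple T -> R) :
  measurable_fun [set: n.-tuple T] f -> (forall u, 0 <= f u) ->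
  \int[M]_u f (flip v u) = \int[M]_u f u.
Proof.
move=> mf f0; have [m1 m1E] := pushforward_measure M (measurable_flip v).
transitivity (fine (\int[m1]_u (f u)%:E)%E); last first.
  congr fine; apply: eq_measure_integral => B mB _.
  by rewrite m1E; exact: product_law_flip.
rewrite m1E ge0_integral_pushforward//.
- exact: measurable_flip.
- exact/measurable_EFinP.
- by move=> u _; rewrite lee_fin.
Qed.

(** Each of the 2^n flips leaves the integral of [code_information] unchanged; their sum is |C|
    times the sum over all words by [sum_code_information], which cancels the prefactor 2^n /
    |C|. *)
Lemma cond_entropy_average : cond_entropy P X Y =
  (\int[M]_u (\sum_v word_pmf (tuple_bias u) v *
    (ln (coset_pmf C (tuple_bias u) v) - ln (word_pmf (tuple_bias u) v)))) / ln 2.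
Proof.
set L := fun u => \sum_v _.
have C0 : #|C|%:R != 0 :> R by rewrite pnatr_eq0 -lt0n card_code_gt0.
have ln20 : ln 2 != 0 :> R by rewrite gt_eqF// ln_gt0// ltr1n.
suff : 2 ^+ n * \int[M]_u code_information C (tuple_bias u) =
    #|C|%:R * \int[M]_u L u.
  move=> e; rewrite cond_entropy_information.
  transitivity ((2 ^+ n * \int[M]_u code_information C (tuple_bias u)) /
      (#|C|%:R * ln 2)).
    by rewrite mulrAC.
  by rewrite e; field; rewrite C0 ln20.
have intf v : M.-integrable setT
    (EFin \o (fun u => code_information C (tuple_bias (flip v u)))).
  apply: (@integrable_bounded _ _ _ _ _ #|C|%:R).
    exact: (measurableT_comp measurable_code_information (measurable_flip v)).
  by move=> u; exact: code_information_bound.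
have -> : 2 ^+ n * \int[M]_u code_information C (tuple_bias u) =
    \sum_v \int[M]_u code_information C (tuple_bias (flip v u)).
  rewrite (eq_bigr (fun=> \int[M]_u code_information C (tuple_bias u))) => [|v _].
    by rewrite sumr_const card_mx card_Fp// mul1n -natrX mulr_natl.
  apply: (Rintegral_flip v measurable_code_information) => u.
  exact: code_information_ge0.
rewrite -Rintegral_sum//.
have LE u : L u =
    #|C|%:R^-1 * \sum_v code_information C (tuple_bias (flip v u)).
  under eq_bigr do rewrite tuple_bias_flip.
  by rewrite sum_code_information mulrA mulVf// mul1r.
under [in RHS]eq_Rintegral do rewrite LE.
rewrite [in RHS]RintegralZl//; last exact: integrable_Rsum.
by rewrite mulrA divff// mul1r.
Qed.

End output_flip.

End code_transmission.

(** * The bound *)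

Section entropy_bound.
Context {R : realType} {d : measure_display} {T : measurableType d} {n m : nat}.
Variables (C : {vspace 'rV['F_2]_n}) (H : 'M['F_2]_(m, n)).
Hypothesis HC : full_rank_parity_check C H.
Variables (nu : probability T R) (t : T -> R) (M : probability (n.-tuple T) R).
Hypotheses (mt : measurable_fun [set: T] t) (t1 : forall y, `|t y| <= 1).
Hypothesis HM : is_product_law nu M.

Let moment k := \int[nu]_y (t y ^+ (2 * k)).

Let even_power_ge0 k y : 0 <= t y ^+ (2 * k).
Proof. by rewrite exprn_even_ge0// oddM. Qed.

Let integrable_power k :
  nu.-integrable [set: T] (EFin \o (fun y => t y ^+ (2 * k))).
Proof.
apply: (@integrable_bounded _ _ _ _ _ 1) => [|y]; first exact: measurable_funX.
by rewrite normrX exprn_ile1.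
Qed.

Let integrable_entropy :
  nu.-integrable [set: T] (EFin \o (@nat_entropy R \o t)).
Proof.
apply: (@integrable_bounded _ _ _ _ _ 2) => [|y].
  exact: (measurableT_comp (measurable_nat_entropy (R := R)) mt).
exact: nat_entropy_bound.
Qed.

Let check_power k j (u : n.-tuple T) :=
  \prod_(i in row_support H j) t (tnth u i) ^+ (2 * k).

Let integrable_check_power k j :
  M.-integrable [set: n.-tuple T] (EFin \o check_power k j).
Proof.
apply: (@integrable_bounded _ _ _ _ _ 1) => [|u].
  rewrite /check_power; under eq_fun do rewrite big_mkcond /=.
  apply: (measurable_prod_tnth
    (f := fun i y => if i \in row_support H j then t y ^+ (2 * k) else 1)) => i.
  by case: (i \in row_support H j) => //; exact: measurable_funX.
rewrite normr_prod prodr_ile1// => i _.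
by rewrite normr_ge0 normrX exprn_ile1.
Qed.

Let integrable_coordinate_entropy i :
  M.-integrable [set: n.-tuple T]
    (EFin \o (fun u => nat_entropy (t (tnth u i)))).
Proof.
apply: (@integrable_bounded _ _ _ _ _ 2) => [|u]; last exact: nat_entropy_bound.
apply: (measurableT_comp (measurable_nat_entropy (R := R))).
by apply: (measurableT_comp mt); exact: measurable_tnth.
Qed.

Let information u := \sum_v word_pmf (tuple_bias t u) v *
  (ln (coset_pmf C (tuple_bias t u) v) - ln (word_pmf (tuple_bias t u) v)).

Let integrable_information :
  M.-integrable [set: n.-tuple T] (EFin \o information).
Proof.
apply: integrable_Rsum => v.
apply: (@integrable_bounded _ _ _ _ _ 1) => [|u].
  apply: measurable_funM; first exact: measurable_word_pmf.
  apply: measurable_funB; apply: measurableT_comp => //.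
    exact: measurable_coset_pmf.
  exact: measurable_word_pmf.
have /andP[i0 i1] := coset_term_bound C v (fun i => t1 (tnth u i)).
by rewrite ger0_norm.
Qed.

Lemma information_lower N :
  n%:R * (\int[nu]_y nat_entropy (t y)) - m%:R * ln 2 +
    2^-1 * \sum_(j < m) \sum_(1 <= k < N)
      entropy_coef k * moment k ^+ row_degree H j
  <= \int[M]_u information u.
Proof.
pose f1 u := \sum_(i < n) nat_entropy (t (tnth u i)).
pose f2 u := \sum_(j < m) \sum_(1 <= k < N) entropy_coef k * check_power k j u.
have i1 : M.-integrable setT (EFin \o f1) by exact: integrable_Rsum.
have ick k j : M.-integrable setT
    (EFin \o (fun u => entropy_coef k * check_power k j u)).
  exact: (integrableZl measurableT (entropy_coef k) (integrable_check_power k j)).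
have i2j j : M.-integrable setT
    (EFin \o (fun u => \sum_(1 <= k < N) entropy_coef k * check_power k j u)).
  by apply: integrable_Rsum => k; exact: ick.
have i2 : M.-integrable setT (EFin \o f2) by exact: integrable_Rsum.
have ic : M.-integrable setT (EFin \o cst (m%:R * ln 2 : R)).
  by apply: (@integrable_bounded _ _ _ _ _ `|m%:R * ln 2|) => // u.
have i1c : M.-integrable setT (EFin \o (fun u => f1 u - cst (m%:R * ln 2) u)).
  exact: (integrableB measurableT i1 ic).
have i2h : M.-integrable setT (EFin \o (fun u => 2^-1 * f2 u)).
  exact: (integrableZl measurableT 2^-1 i2).
have -> : n%:R * (\int[nu]_y nat_entropy (t y)) - m%:R * ln 2 +
    2^-1 * \sum_(j < m) \sum_(1 <= k < N)
      entropy_coef k * moment k ^+ row_degree H j =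
    \int[M]_u ((f1 u - cst (m%:R * ln 2) u) + 2^-1 * f2 u).
  rewrite (RintegralD measurableT i1c i2h) (RintegralB measurableT i1 ic).
  rewrite Rintegral_cst_probability (RintegralZl _ measurableT i2).
  congr (_ - _ + _ * _).
    rewrite /f1 Rintegral_sum//.
    rewrite (eq_bigr (fun=> \int[nu]_y nat_entropy (t y))) => [|i _].
      by rewrite sumr_const card_ord mulr_natl.
    (* A product over the single index i gives the marginal of one output. *)
    have := product_law_Rintegral HM (pred1 i) (fun y => nat_entropy_ge0 (t1 y))
      integrable_entropy.
    rewrite big_pred1_eq => <-.
    by apply: eq_Rintegral => u _; rewrite big_pred1_eq.
  rewrite /f2 Rintegral_sum//; apply: eq_bigr => j _.
  rewrite Rintegral_sum//; apply: eq_bigr => k _.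
  rewrite (RintegralZl _ measurableT (integrable_check_power k j)); congr (_ * _).
  rewrite (product_law_Rintegral HM _ (even_power_ge0 k) (integrable_power k)).
  by rewrite prodr_const.
(* It remains to compare the integrands for fixed outputs, one parity check at a time. *)
apply: le_Rintegral => //.
  exact: (integrableD measurableT i1c i2h).
move=> u _; have tb i : `|tuple_bias t u i| <= 1 by exact: t1.
apply: le_trans (code_entropy_lower HC tb).
rewrite /f1 -addrA lerD2l /cst /f2 mulr_sumr.
rewrite mulr_natl -[in m in _ *+ m](card_ord m) -sumr_const -sumrN -sumrN -big_split.
apply: ler_sum => j _ /=.
rewrite addrC -opprB lerN2.
apply: le_trans (nat_entropy_le N (check_bias_le1 H j tb)) _.
rewrite le_eqVlt; apply/orP; left; apply/eqP; congr (_ - _ * _).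
rewrite horner_entropy_poly; apply: eq_bigr => k _; congr (_ * _).
by rewrite /check_bias /check_power prodrXl.
Qed.

End entropy_bound.

Lemma horner_Gamma {R : realType} {n m : nat} (H : 'M['F_2]_(m, n)) (x : R) :
  m%:R * (Gamma H).[x] = \sum_(j < m) x ^+ row_degree H j.
Proof.
(* With no rows the degree fractions are 0 / 0; the factor m makes both sides 0. *)
case: m H => [|m] H; first by rewrite mul0r big_ord0.
have deg_lt j : (row_degree H j < n.+1)%N.
  by rewrite ltnS -[X in (_ <= X)%N]card_ord max_card.
rewrite horner_poly mulr_sumr.
transitivity (\sum_(k < n.+1) \sum_(j < m.+1 | row_degree H j == k)
    x ^+ row_degree H j).
  apply: eq_bigr => k _; rewrite /degree_fraction mulrA mulrC.
  rewrite (eq_bigr (fun=> x ^+ k)) => [|j /eqP -> //].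
  rewrite sumr_const -[RHS]mulr_natr; congr (_ * _).
  by rewrite mulrCA divff ?mulr1// pnatr_eq0.
rewrite (exchange_big_dep xpredT)//=; apply: eq_bigr => j _.
by rewrite (big_pred1 (Ordinal (deg_lt j))).
Qed.

Theorem theorem2p1 (R : realType) (d d' : measure_display)
    (T : measurableType d) (mu : {sigma_finite_measure set T -> \bar R})
    (p : 'F_2 -> T -> R)
    (n : nat) (C : {vspace 'rV['F_2]_n}) (m : nat) (H : 'M['F_2]_(m, n))
    (Omega : measurableType d') (P : probability Omega R)
    (X : Omega -> 'rV['F_2]_n) (Y : Omega -> n.-tuple T) :
  (0 < n)%N ->
  MBIOS mu p ->
  full_rank_parity_check C H ->
  transmission mu p C P X Y ->
  cond_entropy P X Y / n%:R >=
    1 - capacity mu p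
    - (1 - rate C) *
      (1 - (2 * ln 2)^-1 *
           limn (fun N => \sum_(1 <= k < N)
                   (Gamma H).[g_ mu p k] / (k%:R * (2 * k%:R - 1)))).
Proof.
move=> n0 Hp HC [mX mY unifX memY].
have [nu nuE] := mean_law Hp.
have [s [ms nus bs]] := output_involution Hp nuE.
have [M HM] := exists_product_law nu n.
have [PY PYE] := pushforward_probability P mY.
have mb := measurable_bias Hp; have b1 := bias_le1 Hp.
have law c (B : 'I_n -> set T) : (forall i, measurable (B i)) ->
    P ([set w | X w = c] `&` Y @^-1` rectangle B) =
    (((c \in C)%:R / #|C|%:R)%:E *
    \prod_(i < n) \int[nu]_(y in B i) (2 * bern (bias p y) (c ord0 i))%:E)%E.
  move=> mB; rewrite [LHS](memY c B mB) unifX; congr (_ * _)%E.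
    by case: (c \in C); rewrite ?mul1r ?mul0r.
  by apply: eq_bigr => i _; rewrite (output_lawE Hp nuE).
have HXY := cond_entropy_average mb b1 HM mX mY law PYE ms nus bs.
have ln20 : 0 < ln 2 :> R by rewrite ln_gt0// ltr1n.
have nR0 : 0 < n%:R :> R by rewrite ltr0n.
pose S N : R :=
  \sum_(1 <= k < N) (Gamma H).[g_ mu p k] / (k%:R * (2 * k%:R - 1)).
(* The bound for truncated series, multiplied by n; the limit in N is taken afterwards. *)
have lowerN N :
    n%:R * (1 - capacity mu p) - m%:R + (2 * ln 2)^-1 * (m%:R * S N) <=
    cond_entropy P X Y.
  rewrite HXY ler_pdivlMr//; apply: le_trans (information_lower HC mb b1 HM N).
  have -> : \sum_(j < m) \sum_(1 <= k < N) entropy_coef k *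
      (\int[nu]_y (bias p y ^+ (2 * k))) ^+ row_degree H j = m%:R * S N.
    rewrite exchange_big /S mulr_sumr !big_nat; apply: eq_bigr => k /andP[k1 _].
    rewrite -mulr_sumr mulrA horner_Gamma -(gE Hp nuE k1) mulrC.
    by [].
  rewrite (capacityE Hp nuE) le_eqVlt; apply/orP; left; apply/eqP.
  by field; rewrite gt_eqF.
have rateE : 1 - rate C = m%:R / n%:R :> R.
  have nN0 : n%:R != 0 :> R by rewrite gt_eqF.
  apply: (mulIf nN0); rewrite /rate mulrBl mul1r !divfK//.
  by rewrite -{1}(dim_code HC) natrD addrC addKr.
rewrite rateE.
(* Without parity checks the series has coefficient 0 and the empty truncation suffices; otherwise
   one may divide by m. *)
set l := limn _; have [m0|m0] := posnP m.
  have := lowerN 0; rewrite m0 !mul0r mulr0 addr0 !subr0 => low.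
  by rewrite ler_pdivlMr// mulrC.
have mR0 : 0 < m%:R :> R by rewrite ltr0n.
(* [lowerN] solved for the partial sum: a bound uniform in N. *)
pose K : R := (cond_entropy P X Y - n%:R * (1 - capacity mu p) + m%:R) *
  (2 * ln 2) / m%:R.
have SK N : S N <= K.
  rewrite ler_pdivlMr// -ler_pdivrMr ?mulr_gt0// mulrC [S N * _]mulrC.
  by have := lowerN N; lra.
(* The terms are nonnegative because g_k is an even moment; monotone and bounded by K, the partial
   sums converge, so [limn] is a true limit and inherits the bound. *)
have Snd : {homo S : N N' / (N <= N')%N >-> N <= N'}.
  apply/nondecreasing_seqP => -[|N]; first by rewrite /S !big_geq.
  rewrite /S [leRHS]big_nat_recr//= lerDl -/(entropy_coef _).
  rewrite mulr_ge0 ?entropy_coef_ge0// (gE Hp nuE)// horner_poly.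
  rewrite sumr_ge0// => k _.
  rewrite mulr_ge0 ?divr_ge0// exprn_ge0// Rintegral_ge0// => y _.
  by rewrite exprn_even_ge0// oddM.
have lK : l <= K.
  apply: limr_le; last by apply: nearW => N; exact: SK.
  by apply: (nondecreasing_is_cvgn Snd); exists K => _ [N _ <-]; exact: SK.
have low : m%:R * ((2 * ln 2)^-1 * l) <=
    cond_entropy P X Y - n%:R * (1 - capacity mu p) + m%:R.
  have -> : m%:R * ((2 * ln 2)^-1 * l) = l * m%:R / (2 * ln 2) by ring.
  by rewrite ler_pdivrMr ?mulr_gt0// -ler_pdivlMr.
rewrite ler_pdivlMr//; move: low; set x := (2 * ln 2)^-1 * l => low.
have -> : (1 - capacity mu p - m%:R / n%:R * (1 - x)) * n%:R =
    n%:R * (1 - capacity mu p) - m%:R * (1 - x).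
  by field; rewrite gt_eqF.
lra.
Qed.
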